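(* Assume that (A1)–(A4) of the context hold, and let $Y_k^{j,N}$ be the projected Euler scheme described in the context. Then for any $1\le p<\lfloor\frac{q_0}{2}\rfloor$ and any $0<h\le h_2:=\min\{h_1,\frac{1}{p(a_1-a_2)}\}$, $$\sup_{1\le j\le N}\mathbb{E}\left[|Y_k^{j,N}|^{2p}\right]\le K_6\sup_{1\le j\le N}\mathbb{E}\left[1+|X_0^j|^{4p}\right]=K_6\,\mathbb{E}\left[1+|X_0|^{4p}\right]\qquad(k\ge0),$$ where $K_6$ is a constant independent of $h,k,N$.
   Context: Notation. $|\cdot|$ and $\langle\cdot,\cdot\rangle$ are the Euclidean norm and inner product on $\mathbb{R}^d$; $\|B\|=\sqrt{\operatorname{trace}(BB^T)}$ is the Hilbert–Schmidt norm. $\mathcal{P}_2(\mathbb{R}^d)$ is the set of probability measures on $\mathbb{R}^d$ with finite second moment, $\mathcal{W}_2(\mu,\nu)$ is the $L^2$-Wasserstein distance, $\mathcal{W}_2(\mu):=(\int|x|^2\mu(dx))^{1/2}$, and $\delta_x$ is the Dirac measure at $x$. Data. On a complete filtered probability space $(\Omega,\mathcal F,(\mathcal F_t)_{t\ge0},\mathbb P)$ let $W$ be an $m$-dimensional Brownian motion and $X_0$ an $\mathcal{F}_0$-measurable $\mathbb{R}^d$-valued random variable independent of $W$; let $b:\mathbb{R}^d\times\mathcal{P}_2(\mathbb{R}^d)\to\mathbb{R}^d$, $\sigma:\mathbb{R}^d\times\mathcal{P}_2(\mathbb{R}^d)\to\mathbb{R}^{d\times m}$. Assumptions. (A1) There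 are constants $K_1>K_2\ge0$, $K_1>0$, such that for all $x,y\in\mathbb{R}^d$, $\mu,\nu\in\mathcal{P}_2(\mathbb{R}^d)$: $2\langle x-y,b(x,\mu)-b(y,\nu)\rangle+\|\sigma(x,\mu)-\sigma(y,\nu)\|^2\le -K_1|x-y|^2+K_2\mathcal{W}_2(\mu,\nu)^2$. (A2) There are constants $L_1>0$, $\kappa\ge1$ such that for all $x,y,\mu,\nu$: $|b(x,\mu)-b(y,\nu)|^2\le L_1[(1+|x|^{2\kappa-2}+|y|^{2\kappa-2})|x-y|^2+\mathcal{W}_2(\mu,\nu)^2]$. (A3) There are constants $L_2>0$ and $q_0\ge20$ with $\mathbb{E}[|X_0|^{2q_0}]<\infty$ and $|b(0,\delta_0)|\le L_2$. (A4) There are constants $a_1>a_2\ge0$, $q^*\ge 4q_0-2$, $C\ge0$ such that for all $x,\mu$: $2\langle x,b(x,\mu)\rangle+(q^*-1)\|\sigma(x,\mu)\|^2\le -a_1|x|^2+a_2\mathcal{W}_2(\mu)^2+C$. Projected Euler scheme. For $N\ge1$ let $(W^j,X_0^j)$, $1\le j\le N$, be i.i.d. copies of $(W,X_0)$. Uniform step size $h=1/M$ ($M\ge1$), $t_k=kh$. With $\kappa$ from (A2), $\psi(x)=\min\{1,h^{-\frac{1}{2(\kappa+2)}}|x|^{-1}\}x$ for $x\in\mathbb{R}^d$, $\psi(0)=0$. Set $Y_0^{j,N}=X_0^j$ and, for $k\ge0$, $\bar Y_k^{j,N}=\psi(Y_k^{j,N})$, $\mu_k^{\bar Y,N}=\frac1N\sum_{i=1}^N\delta_{\bar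 Y_k^{i,N}}$, $Y_{k+1}^{j,N}=\bar Y_k^{j,N}+h\,b(\bar Y_k^{j,N},\mu_k^{\bar Y,N})+\sigma(\bar Y_k^{j,N},\mu_k^{\bar Y,N})(W^j_{t_{k+1}}-W^j_{t_k})$. Step-size bound. $h_1:=\min\{\frac{1}{2(K_1-K_2)},h_0\}$, where $h_0\in(0,1]$ is a fixed constant. *)

(* Defs.v *)
From HB Require Import structures.
From mathcomp Require Import all_boot all_order all_algebra.
From mathcomp Require Import all_classical all_reals all_analysis.
From mathcomp Require Import measurable_realfun probability_measure.

Set Implicit Arguments.
Unset Strict Implicit.
Unset Printing Implicit Defensive.

Import Order.TTheory GRing.Theory Num.Theory.
Import numFieldNormedType.Exports.

Local Open Scope classical_set_scope.
Local Open Scope ring_scope.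

(* Borel sigma-algebra on matrices; R^d is 'cV[R]_d. *)
HB.instance Definition _ (R : realType) (m n : nat) :=
  @isMeasurable.Build (sigma_display (@open 'M[R]_(m, n))) 'M[R]_(m, n)
    <<s @open 'M[R]_(m, n) >>
    (@sigma_algebra0 _ setT (@open 'M[R]_(m, n)))
    (@sigma_algebraC _ (@open 'M[R]_(m, n)))
    (@sigma_algebra_bigcup _ setT (@open 'M[R]_(m, n))).

Section EuclideanSpace.
Context {R : realType}.

Definition dot (d : nat) (x y : 'cV[R]_d) : R := \sum_(i < d) x i ord0 * y i ord0.

(* The library norm `|x| on matrices is the sup norm, so the Euclidean norm is
   defined here. *)
Definition enorm (d : nat) (x : 'cV[R]_d) : R := Num.sqrt (dot x x).

Definition hsnorm (d m : nat) (B : 'M[R]_(d, m)) : R := Num.sqrt (\tr (B *m B^T)).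

Lemma dot_ge0 d (x : 'cV[R]_d) : 0 <= dot x x.
Proof. by apply: sumr_ge0 => i _; rewrite -expr2 sqr_ge0. Qed.

Lemma enorm_sqr d (x : 'cV[R]_d) : enorm x ^+ 2 = dot x x.
Proof. by rewrite sqr_sqrtr// dot_ge0. Qed.

Lemma measurable_coord d (i : 'I_d) :
  measurable_fun [set: 'cV[R]_d] (fun x : 'cV[R]_d => x i ord0).
Proof.
apply: (measurability _ (RGenOpens.measurableE R)).
move=> _ [_ [a [b ->] <-]]; rewrite setTI; apply: sub_sigma_algebra => /=.
have /continuousP := @coord_continuous R d 1 i ord0; apply.
exact: interval_open.
Qed.

Lemma measurable_enorm_sqr d :
  measurable_fun [set: 'cV[R]_d] (fun x : 'cV[R]_d => (enorm x ^+ 2)%:E).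
Proof.
apply/measurable_EFinP.
under [X in measurable_fun _ X]eq_fun do rewrite enorm_sqr.
apply: measurable_sum => i.
by apply: measurable_funM; exact: measurable_coord.
Qed.

End EuclideanSpace.

Section WassersteinSpace.
Context {R : realType}.

Record P2 (d : nat) : Type := MkP2 {
  P2_measure :> probability 'cV[R]_d R ;
  P2_moment : (\int[P2_measure]_x (enorm x ^+ 2)%:E < +oo)%E }.

Definition coupling (d : nat) (mu nu : P2 d)
    (pi : probability ('cV[R]_d * 'cV[R]_d)%type R) : Prop :=
  forall A : set 'cV[R]_d, measurable A ->
    pi (A `*` setT) = mu A /\ pi (setT `*` A) = nu A.

Definition W2 (d : nat) (mu nu : P2 d) : R :=
  Num.sqrt (fine (ereal_inf
    [set (\int[pi]_z (enorm (z.1 - z.2) ^+ 2)%:E)%E | pi in coupling mu nu])).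

(* The W_2 distance to the Dirac mass at 0, as a second moment. *)
Definition W2_0 (d : nat) (mu : P2 d) : R :=
  Num.sqrt (fine (\int[mu]_x (enorm x ^+ 2)%:E)%E).

Section Dirac.
Variables (d : nat) (a : 'cV[R]_d).

Lemma dirac_moment :
  (\int[(\d_a : probability 'cV[R]_d R)]_x (enorm x ^+ 2)%:E < +oo)%E.
Proof.
rewrite integral_dirac//; last exact: measurable_enorm_sqr.
by rewrite diracT mul1e ltry.
Qed.

Definition diracP2 : P2 d := MkP2 dirac_moment.

End Dirac.

Section Empirical.
Variables (d N : nat) (N_gt0 : (0 < N)%N) (x : 'I_N -> 'cV[R]_d).

Definition empirical_fun (A : set 'cV[R]_d) : \bar R :=
  ((N%:R^-1)%:E * \sum_(i < N) \d_(x i) A)%E.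

Let x' (k : nat) : 'cV[R]_d := if insub k is Some i then x i else 0.
Let mx : {measure set 'cV[R]_d -> \bar R} := mscale ((N%:R^-1)%:nng : {nonneg R})
            (msum (fun k => \d_(x' k) : {measure set 'cV[R]_d -> \bar R}) N).

Let empirical_mx : empirical_fun = mx.
Proof.
apply/funext => A; rewrite /empirical_fun /mx /mscale/= /msum/=.
by congr (_ * _)%E; apply: eq_bigr => i _; rewrite /x' valK.
Qed.

Let empirical0 : empirical_fun set0 = 0%E.
Proof. by rewrite empirical_mx measure0. Qed.

Let empirical_ge0 A : (0 <= empirical_fun A)%E.
Proof. by rewrite empirical_mx measure_ge0. Qed.

Let empirical_sigma_additive : semi_sigma_additive empirical_fun.
Proof. by rewrite empirical_mx; exact: measure_semi_sigma_additive. Qed.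

Let empirical_measure : {measure set 'cV[R]_d -> \bar R} :=
  HB.pack empirical_fun (isMeasure.Build _ _ _ empirical_fun
    empirical0 empirical_ge0 empirical_sigma_additive).

Let empiricalT : empirical_fun setT = 1%E.
Proof.
rewrite /empirical_fun; under eq_bigr do rewrite diracT.
rewrite sumEFin sumr_const card_ord -EFinM mulVf//.
by rewrite pnatr_eq0 -lt0n.
Qed.

Definition empirical_probability : probability 'cV[R]_d R :=
  HB.pack empirical_fun empirical_measure
    (Measure_isProbability.Build _ _ _ empirical_measure empiricalT).

Lemma empirical_probabilityE A : empirical_probability A = empirical_fun A.
Proof. by []. Qed.

Lemma empirical_moment :
  (\int[empirical_probability]_y (enorm y ^+ 2)%:E < +oo)%E.
Proof.
have mf := @measurable_enorm_sqr R d.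
have f0 (y : 'cV[R]_d) : [set: 'cV[R]_d] y -> (0 <= (enorm y ^+ 2)%:E)%E.
  by move=> _; rewrite lee_fin sqr_ge0.
rewrite (eq_measure_integral mx); last first.
  by move=> A _ _; rewrite -empirical_mx.
rewrite ge0_integral_mscale// ge0_integral_measure_sum//.
under eq_bigr do rewrite integral_dirac// diracT mul1e.
by rewrite sumEFin -EFinM ltry.
Qed.

Definition empirical : P2 d := MkP2 empirical_moment.

End Empirical.

End WassersteinSpace.
Arguments P2 : clear implicits.
Arguments P2 R d : assert.

Section Coefficients.
Context {R : realType} {d m : nat}.
Variables (b : 'cV[R]_d -> P2 R d -> 'cV[R]_d)
          (sigma : 'cV[R]_d -> P2 R d -> 'M[R]_(d, m)).

Definition dissipative (K1 K2 : R) : Prop :=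
  [/\ K1 > K2, K2 >= 0, K1 > 0 &
   forall (x y : 'cV[R]_d) (mu nu : P2 R d),
     2 * dot (x - y) (b x mu - b y nu) + hsnorm (sigma x mu - sigma y nu) ^+ 2
     <= - K1 * enorm (x - y) ^+ 2 + K2 * W2 mu nu ^+ 2].

Definition polynomial_lipschitz (L1 kappa : R) : Prop :=
  [/\ L1 > 0, kappa >= 1 &
   forall (x y : 'cV[R]_d) (mu nu : P2 R d),
     enorm (b x mu - b y nu) ^+ 2
     <= L1 * ((1 + enorm x `^ (2 * kappa - 2) + enorm y `^ (2 * kappa - 2))
                * enorm (x - y) ^+ 2 + W2 mu nu ^+ 2)].

Definition coercive (q0 qstar a1 a2 C : R) : Prop :=
  [/\ a1 > a2, a2 >= 0, qstar >= 4 * q0 - 2, C >= 0 &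
   forall (x : 'cV[R]_d) (mu : P2 R d),
     2 * dot x (b x mu) + (qstar - 1) * hsnorm (sigma x mu) ^+ 2
     <= - a1 * enorm x ^+ 2 + a2 * W2_0 mu ^+ 2 + C].

End Coefficients.

Section Probability.
Context {dO : measure_display} {Omega : measurableType dO} {R : realType}.
Variable P : probability Omega R.

Definition moment_bound (d : nat) (b : 'cV[R]_d -> P2 R d -> 'cV[R]_d)
    (X0 : Omega -> 'cV[R]_d) (L2 q0 : R) : Prop :=
  [/\ L2 > 0, q0 >= 20,
   ('E_P[fun w => (enorm (X0 w) `^ (2 * q0))%R] < +oo)%E &
   enorm (b 0 (diracP2 0)) <= L2].

(* Time ranges over the nonnegative reals: filtrations and processes are
   indexed by R, and their values at negative times are never used. *)
Definition complete_filtration (Ft : R -> set_system Omega) : Prop :=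
  [/\ measure_is_complete P,
      forall t, 0 <= t -> sigma_algebra setT (Ft t) /\ Ft t `<=` measurable,
      forall s t, 0 <= s -> s <= t -> Ft s `<=` Ft t &
      forall A, P.-negligible A -> Ft 0 A].

Definition adapted_to (d : nat) (G : set_system Omega)
    (X : Omega -> 'cV[R]_d) : Prop :=
  forall B : set 'cV[R]_d, measurable B -> G (X @^-1` B).

Definition independent_systems (G H : set_system Omega) : Prop :=
  forall A B, G A -> H B -> P (A `&` B) = (P A * P B)%E.

Definition generated_by (d : nat) (X : Omega -> 'cV[R]_d) : set_system Omega :=
  preimage_set_system setT X measurable.

Definition generated_by_process (m : nat) (W : R -> Omega -> 'cV[R]_m) :
    set_system Omega :=
  <<s \bigcup_(t in [set t | 0 <= t]) generated_by (W t) >>.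

(* Law N(0, v I_m), given by its values on measurable boxes; the second argument
   of normal_prob is the standard deviation. *)
Definition centered_gaussian (m : nat) (X : Omega -> 'cV[R]_m) (v : R) : Prop :=
  forall B : 'I_m -> set R, (forall i, measurable (B i)) ->
    P [set w | forall i, B i (X w i ord0)] =
    (\prod_(i < m) normal_prob 0 (Num.sqrt v) (B i))%E.

Definition brownian_motion (m : nat) (Ft : R -> set_system Omega)
    (W : R -> Omega -> 'cV[R]_m) : Prop :=
  [/\ {ae P, forall w, W 0 w = 0},
      {ae P, forall w, {within [set t | 0 <= t], continuous (fun t => W t w)}},
      forall t, 0 <= t -> adapted_to (Ft t) (W t),
      forall s t, 0 <= s -> s < t ->
        independent_systems (Ft s) (generated_by (fun w => W t w - W s w)) &
      forall s t, 0 <= s -> s < t ->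
        centered_gaussian (fun w => W t w - W s w) (t - s)].

(* Product sigma-algebra on (R^m)^[0, oo) x R^d, in which (W, X_0) takes its
   values. *)
Definition path_events (m d : nat) : set_system ((R -> 'cV[R]_m) * 'cV[R]_d) :=
  <<s [set A | (exists t B, [/\ 0 <= t, measurable B &
                  A = [set z : (R -> 'cV[R]_m) * 'cV[R]_d | B (z.1 t)]])
             \/ (exists2 B, measurable B &
                  A = [set z : (R -> 'cV[R]_m) * 'cV[R]_d | B z.2])] >>.

Definition iid_copies (m d N : nat)
    (W : R -> Omega -> 'cV[R]_m) (X0 : Omega -> 'cV[R]_d)
    (Wc : 'I_N -> R -> Omega -> 'cV[R]_m) (X0c : 'I_N -> Omega -> 'cV[R]_d) :
    Prop :=
  let xi w := (W ^~ w, X0 w) in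
  let xic j w := (Wc j ^~ w, X0c j w) in
  [/\ forall j A, path_events A -> measurable (xic j @^-1` A),
      forall j A, path_events A -> P (xic j @^-1` A) = P (xi @^-1` A) &
      forall (J : {set 'I_N}) (A : 'I_N -> set ((R -> 'cV[R]_m) * 'cV[R]_d)),
        (forall j, path_events (A j)) ->
        P (\bigcap_(j in [set` J]) xic j @^-1` A j) =
        (\prod_(j in J) P (xic j @^-1` A j))%E].

End Probability.

Section ProjectedEuler.
Context {R : realType} {d m : nat}.
Variables (b : 'cV[R]_d -> P2 R d -> 'cV[R]_d)
          (sigma : 'cV[R]_d -> P2 R d -> 'M[R]_(d, m)).
Variables (kappa h : R).

(* At x = 0 this is 0. *)
Definition euler_proj (x : 'cV[R]_d) : 'cV[R]_d :=
  Num.min 1 (h `^ (- (2 * (kappa + 2))^-1) * (enorm x)^-1) *: x.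

Variables (Omega : Type) (N : nat) (N_gt0 : (0 < N)%N).
Variables (Wc : 'I_N -> R -> Omega -> 'cV[R]_m) (X0c : 'I_N -> Omega -> 'cV[R]_d).

Fixpoint euler (k : nat) (j : 'I_N) (w : Omega) : 'cV[R]_d :=
  if k is k'.+1 then
    let Ybar i := euler_proj (euler k' i w) in
    let mu := empirical N_gt0 Ybar in
    Ybar j + h *: b (Ybar j) mu
      + sigma (Ybar j) mu *m (Wc j (k'.+1%:R * h) w - Wc j (k'%:R * h) w)
  else X0c j w.

End ProjectedEuler.

(* Main.v *)
Require Import Defs.
From HB Require Import structures.
From mathcomp Require Import all_boot all_order all_algebra.
From mathcomp Require Import all_classical all_reals all_analysis.
From mathcomp Require Import measurable_realfun probability_measure.
From mathcomp Require Import ring lra.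

Set Implicit Arguments.
Unset Strict Implicit.
Unset Printing Implicit Defensive.

Import Order.TTheory GRing.Theory Num.Theory.
Import numFieldNormedType.Exports.

Local Open Scope classical_set_scope.
Local Open Scope ring_scope.

(** The moments of the scheme are bounded because one step cannot increase a bound
    that is already large.

    An even integer exponent 2 n with p < n <= q0 / 2 is enough, since
    |y|^(2 p) <= 1 + |y|^(2 n). Let x be the projected position of a particle at
    step k, mu the empirical measure, w its second moment and u = x + h b(x, mu).
    Given the past, the next position is u plus a centred Gaussian vector of
    covariance h sigma sigma^T. Gaussian hypercontractivity in degree one bounds
    its conditional moment of order 2 n by the n-th power of

      |u|^2 + (2 n - 1) h ||sigma||^2
        = |x|^2 + h (2 <x, b> + (2 n - 1) ||sigma||^2) + h^2 |b|^2,

    with no remainder in h. Since 2 n - 1 <= qstar - 1, coercivity bounds the middle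
    term by h (- a1 |x|^2 + a2 w + C). The projection onto the ball of radius
    h^(- 1 / (2 (kappa + 2))) makes h |b|^2 at most c eta (1 + |x|^2 + w) with
    eta = h^(3 / (kappa + 2)) ([drift_growth]).

    When eta is small, the gap a1 > a2 turns this into a convex combination of
    |x|^2, w and a constant K, and convexity of the n-th power gives the same
    combination of |x|^(2 n), the mean of the |x_i|^(2 n) and K^n. When eta is not
    small, the radius, which is eta^(- 1 / 6), is bounded, hence so is everything
    ([one_step_drift]). In both cases a common bound of the moments of all the
    particles that exceeds a constant independent of h, k and N is reproduced at
    the next step ([euler_moments_bounded]).

    Hypercontractivity is proved for one Gaussian variable by symmetrization and
    comparison of coefficients ([gaussian_hypercontractivity]) and then iterated
    over the coordinates of the noise ([gaussian_noise_moment_le]). That the noise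
    of step k is independent of the past is read off the joint law of the copies
    ([copies_increment_indep]); that the scheme is measurable for the past follows
    from the continuity of the coefficients along empirical measures
    ([measurable_euler]). *)

(** * Even moments of the centred Gaussian law *)

Section GaussianMoments.
Context {R : realType}.
Variable s : R.
Hypothesis s0 : 0 < s.
Local Notation mu := (@lebesgue_measure R).
Local Notation gam := (normal_prob 0 s).

Let sN0 : s != 0. Proof. by rewrite gt_eqF. Qed.

(** The normal density is a version of the Radon-Nikodym derivative of
    [normal_prob 0 s]: both have the same integral over every measurable set, so
    they agree almost everywhere. *)
Lemma integral_normal_prob (f : R -> \bar R) :
  (forall x, 0 <= f x)%E -> measurable_fun setT f ->
  (\int[gam]_x f x = \int[mu]_x (f x * (normal_pdf 0 s x)%:E))%E.
Proof.
move=> f0 mf.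
have mpdf : measurable_fun setT (EFin \o normal_pdf 0 s).
  by apply/measurable_EFinP; exact: measurable_normal_pdf.
have dom := normal_prob_dominates 0 s.
rewrite -(Radon_Nikodym_SigmaFinite.change_of_variables dom)//.
have iRN := Radon_Nikodym_SigmaFinite.f_integrable dom.
have mRN := measurable_int mu iRN.
apply: ge0_ae_eq_integral => //.
- exact: emeasurable_funM.
- exact: emeasurable_funM.
- by move=> x _; rewrite mule_ge0// Radon_Nikodym_SigmaFinite.f_ge0.
- by move=> x _; rewrite mule_ge0// lee_fin normal_pdf_ge0.
have := integral_ae_eq measurableT iRN mpdf.
have H E : E `<=` setT -> measurable E ->
   (\int[mu]_(x in E) Radon_Nikodym_SigmaFinite.f (normal_prob 0 s) mu x =
    \int[mu]_(x in E) (EFin \o normal_pdf 0 s) x)%E.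
  by move=> _ mE; rewrite -Radon_Nikodym_SigmaFinite.f_integral.
move=> /(_ H); apply: filterS => x /(_ I) Hx _.
by rewrite Hx.
Qed.

Lemma is_derive_normal_pdf (x : R) :
  is_derive x 1 (normal_pdf 0 s) (- (x * normal_pdf 0 s x / s ^+ 2)).
Proof.
rewrite normal_pdfE//= /normal_fun.
apply: is_derive_eq.
rewrite /GRing.scale /= subr0 mulNr; field.
by rewrite sN0.
Qed.

Lemma normal_pdf_even (x : R) : normal_pdf 0 s (- x) = normal_pdf 0 s x.
Proof. by rewrite normal_pdfE//= /normal_fun !subr0 sqrrN. Qed.

(** Integration by parts against the density, whose derivative at x is
    - x / s^2 times itself. On a symmetric interval the boundary term is
    nonnegative, so dropping it leaves the inequality in the useful direction and
    the decay of the density at infinity never enters. *)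
Lemma gaussian_moment_rec_itv (i : nat) (a : R) : 0 < a ->
  (\int[mu]_(x in `[(- a)%R, a]) (x ^+ i.+1.*2 * normal_pdf 0 s x)%:E <=
   (i.*2.+1%:R * s ^+ 2)%:E *
     \int[mu]_(x in `[(- a)%R, a]) (x ^+ i.*2 * normal_pdf 0 s x)%:E)%E.
Proof.
move=> a0.
have cpdf := @continuous_normal_pdf R 0 s sN0.
have cX n : continuous (fun x : R => x ^+ n) by move=> x; exact: exprn_continuous.
have dLR (F : R -> R) : (forall x, derivable F x 1) ->
    derivable_oo_LRcontinuous F (- a) a.
  move=> dF; have cF x : {for x, continuous F}.
    exact/differentiable_continuous/derivable1_diffP.
  by split => // [|]; [apply: cvg_at_right_filter|apply: cvg_at_left_filter];
    exact: cF.
have mpdf := measurable_normal_pdf 0 s.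
have := @integration_by_parts R (fun x => x ^+ i.*2.+1)
  (fun x => - s ^+ 2 * normal_pdf 0 s x)
  (fun x => i.*2.+1%:R * x ^+ i.*2) (fun x => x * normal_pdf 0 s x) (- a) a.
move=> /(_ ltac:(lra)) H.
rewrite (_ : (\int[mu]_(x in `[(- a)%R, a]) (x ^+ i.+1.*2 * normal_pdf 0 s x)%:E =
  \int[mu]_(x in `[(- a)%R, a]) (x ^+ i.*2.+1 * (x * normal_pdf 0 s x))%:E)%E);
  last by apply: eq_integral => x _; rewrite doubleS exprSr; congr EFin; ring.
rewrite H.
- have -> : (\int[mu]_(x in `[(- a)%R, a])
      (i.*2.+1%:R * x ^+ i.*2 * (- s ^+ 2 * normal_pdf 0 s x))%:E =
    (- (i.*2.+1%:R * s ^+ 2)%:E) *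
     \int[mu]_(x in `[(- a)%R, a]) (x ^+ i.*2 * normal_pdf 0 s x)%:E)%E.
    rewrite -EFinN -integralZl//=.
      by apply: eq_integral => x _; rewrite -EFinM; congr EFin; ring.
    apply: continuous_compact_integrable; first exact: segment_compact.
    apply: continuous_subspaceT => x; apply: cvgM; first exact: cX.
    exact: cpdf.
  (* the boundary term is - 2 s^2 a^(2 i + 1) times the density at a *)
  rewrite mulNe oppeK geeDr// lee_fin.
  have := normal_pdf_ge0 0 s a; have := sqr_ge0 s; have : 0 <= a ^+ i.*2.+1 by exact/exprn_ge0/ltW.
  rewrite normal_pdf_even exprNn -signr_odd /= odd_double /= expr1.
  move=> h1 h2 h3.
  rewrite -subr_ge0; have := mulr_ge0 (mulr_ge0 h1 h2) h3; lra.
- apply: continuous_subspaceT => x; apply: cvgM; first exact: cvg_cst.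
  exact: cX.
- by apply: dLR => x; exact: exprn_derivable.
- by move=> x _; exact: exp_derive1.
- apply: continuous_subspaceT => x; apply: cvgM; first exact: cvg_id.
  exact: cpdf.
- apply: dLR => x.
  by apply: derivableM => //; have [] := is_derive_normal_pdf x.
- move=> x _; rewrite derive1E; apply: derive_val.
  have := is_derive_normal_pdf x => dx.
  apply: is_derive_eq; rewrite /GRing.scale/=; field; exact: sN0.
Qed.

Lemma gaussian_moment_rec (i : nat) :
  (\int[gam]_x (x ^+ i.+1.*2)%:E <=
   (i.*2.+1%:R * s ^+ 2)%:E * \int[gam]_x (x ^+ i.*2)%:E)%E.
Proof.
have ev (k : nat) (x : R) : 0 <= x ^+ k.*2.
  by rewrite exprn_even_ge0// odd_double.
have mX k : measurable_fun setT (fun x : R => (x ^+ k)%:E).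
  by apply/measurable_EFinP; exact: measurable_funX.
have mpdf := measurable_normal_pdf 0 s.
have mXp k D : measurable D ->
    measurable_fun D (fun x : R => (x ^+ k * normal_pdf 0 s x)%:E).
  move=> mD; apply/measurable_EFinP/measurable_funTS/measurable_funM => //.
rewrite !integral_normal_prob//; [|by move=> x; rewrite lee_fin ev..].
under eq_integral do rewrite -EFinM.
under [in leRHS]eq_integral do rewrite -EFinM.
pose F k := `[(- k.+1%:R)%R, k.+1%:R : R]%classic.
have UF : \bigcup_k F k = setT.
  apply/seteqP; split=> // x _.
  exists `|Num.ceil `|x| |%N => //=; rewrite /F /= in_itv /= -ler_norml.
  apply: (le_trans (ceil_ge _)); rewrite -natr1 -[leLHS]addr0 lerD//.
  by rewrite natr_absz ler_int ler_norm.
have ndF : nondecreasing_seq F.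
  move=> j k jk; rewrite subsetEset => x; rewrite /F /= !in_itv /= => /andP[h1 h2].
  have : j.+1%:R <= k.+1%:R :> R by rewrite ler_nat.
  move=> h; apply/andP; split; lra.
have cvgF : (\int[mu]_(x in F k) (x ^+ i.+1.*2 * normal_pdf 0 s x)%:E)%E
    @[k --> \oo] --> (\int[mu]_x (x ^+ i.+1.*2 * normal_pdf 0 s x)%:E)%E.
  rewrite -UF; apply: (@ge0_nondecreasing_set_cvg_integral _ (measurableTypeR R)) => //.
  - by move=> k; exact: measurable_itv.
  - by move=> k; apply: mXp; exact: measurable_itv.
  - by move=> k x _; rewrite lee_fin mulr_ge0// normal_pdf_ge0.
rewrite -(cvg_lim _ cvgF)//; apply: lime_le; first by apply/cvg_ex; eexists; exact: cvgF.
apply: nearW => k; apply: le_trans (gaussian_moment_rec_itv _ _) _ => //.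
rewrite lee_wpmul2l ?lee_fin ?(mulr_ge0, sqr_ge0, ltW s0)//.
apply: (@ge0_subset_integral _ (measurableTypeR R)) => //; first exact: mXp.
by move=> x _; rewrite lee_fin mulr_ge0// normal_pdf_ge0.
Qed.

(** The right-hand side is (2 i - 1)!! s^(2 i). *)
Lemma gaussian_moment_le (i : nat) :
  (\int[gam]_x (x ^+ i.*2)%:E <=
   (\prod_(j < i) (j.*2.+1%:R * s ^+ 2))%:E)%E.
Proof.
elim: i => [|i IH].
  rewrite big_ord0; under eq_integral do rewrite expr0.
  by rewrite integral_cst// mul1e; have /= -> := @probability_setT _ _ _ (normal_prob 0 s).
apply: (le_trans (gaussian_moment_rec i)).
rewrite big_ord_recr/= [X in (_ <= X%:E)%E]mulrC [X in (_ <= X)%E]EFinM lee_wpmul2l//.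
by rewrite lee_fin mulr_ge0 ?sqr_ge0.
Qed.

Lemma integral_normal_prob_opp (f : R -> R) :
  (forall x, 0 <= f x) -> measurable_fun setT f ->
  (\int[gam]_x (f (- x))%:E = \int[gam]_x (f x)%:E)%E.
Proof.
move=> f0 mf.
have mfN : measurable_fun setT (fun x : R => f (- x)).
  by apply: (measurableT_comp mf); exact: oppr_measurable.
have mpdf := measurable_normal_pdf 0 s.
rewrite !integral_normal_prob//; try (by move=> x; rewrite lee_fin);
  try exact/measurable_EFinP.
under eq_integral do rewrite -EFinM -normal_pdf_even.
under [RHS]eq_integral do rewrite -EFinM.
have mg : measurable_fun setT (fun x => (f x * normal_pdf 0 s x)%:E).
  by apply/measurable_EFinP/measurable_funM.
transitivity (\int[pushforward mu (-%R : R -> measurableTypeR R)]_x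
    (f x * normal_pdf 0 s x)%:E)%E.
  rewrite ge0_integral_pushforward//.
  by move=> x _; rewrite lee_fin mulr_ge0// normal_pdf_ge0.
by apply: eq_measure_integral => A mA _; exact: lebesgue_measureN.
Qed.

End GaussianMoments.

(** * Gaussian hypercontractivity in degree one *)

(** This comparison of coefficients, with the double factorial (2 i - 1)!! coming
    from Gaussian moments, is where the constant 2 n - 1 of the hypercontractive
    inequality originates: the quotient of the two sides grows at each step of the
    induction by (2 n - 1) / (2 n - 2 i - 1), which is at least 1. *)
Lemma bin_double_le (n i : nat) : (i <= n)%N ->
  ('C(n.*2, i.*2) * \prod_(j < i) j.*2.+1 <= 'C(n, i) * n.*2.-1 ^ i)%N.
Proof.
elim: i => [|i IH] ile; first by rewrite big_ord0 !bin0.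
have {}IH := IH (ltnW ile).
have e1 := mul_bin_left n.*2 i.*2; have e2 := mul_bin_left n.*2 i.*2.+1.
have e3 := mul_bin_left n i.
rewrite big_ord_recr/= doubleS -(@leq_pmul2l i.+1.*2)//.
set P := (\prod_(j < i) _)%N in IH *.
have -> : (i.+1.*2 * ('C(n.*2, i.*2.+2) * (P * i.*2.+1)) =
    (n.*2 - i.*2.+1) * (n.*2 - i.*2) * ('C(n.*2, i.*2) * P))%N.
  have -> : (i.+1.*2 * ('C(n.*2, i.*2.+2) * (P * i.*2.+1)) =
    i.*2.+1 * (i.*2.+2 * 'C(n.*2, i.*2.+2)) * P)%N by rewrite doubleS; ring.
  rewrite e2 (_ : (i.*2.+1 * ((n.*2 - i.*2.+1) * 'C(n.*2, i.*2.+1)) =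
    (n.*2 - i.*2.+1) * (i.*2.+1 * 'C(n.*2, i.*2.+1)))%N); last by ring.
  by rewrite e1; ring.
have -> : (i.+1.*2 * ('C(n, i.+1) * n.*2.-1 ^ i.+1) =
    n.*2.-1 * (n.*2 - i.*2) * ('C(n, i) * n.*2.-1 ^ i))%N.
  rewrite -doubleB expnS -!mul2n.
  have -> : (2 * i.+1 * ('C(n, i.+1) * ((2 * n).-1 * (2 * n).-1 ^ i)) =
    2 * (i.+1 * 'C(n, i.+1)) * ((2 * n).-1 * (2 * n).-1 ^ i))%N by ring.
  by rewrite e3; ring.
by rewrite leq_mul// leq_mul// subnS -!subn1 leq_sub2r// leq_subr.
Qed.

Lemma sum_even_terms (V : nmodType) (F : nat -> V) (n : nat) :
  (forall k, odd k -> F k = 0) ->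
  \sum_(k < n.*2.+1) F k = \sum_(i < n.+1) F i.*2.
Proof.
move=> F0; elim: n => [|n IH]; first by rewrite !big_ord_recl !big_ord0.
rewrite doubleS 2!big_ord_recr/= IH [in RHS]big_ord_recr/= doubleS.
by rewrite (F0 n.*2.+1) ?addr0//= odd_double.
Qed.

Section Hypercontractivity.
Context {R : realType}.

Lemma symmetrized_exprD (n : nat) (X y : R) :
  (X + y) ^+ n + (X - y) ^+ n =
  \sum_(k < n.+1) (X ^+ (n - k) * (y ^+ k + (- y) ^+ k)) *+ 'C(n, k).
Proof.
rewrite !exprDn -big_split/=; apply: eq_bigr => k _.
by rewrite mulrDr mulrnDl.
Qed.

(** Only even powers of y survive in the symmetrization, so it increases with
    the absolute value of y. *)
Lemma symmetrized_exprD_le (n : nat) (X y z : R) : 0 <= X -> y ^+ 2 <= z ^+ 2 ->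
  (X + y) ^+ n + (X - y) ^+ n <= (X + z) ^+ n + (X - z) ^+ n.
Proof.
move=> X0 yz; rewrite !symmetrized_exprD; apply: ler_sum => k _.
apply: ler_wMn2r; apply: ler_wpM2l; first exact: exprn_ge0.
rewrite (exprNn y) (exprNn z) -signr_odd.
have [ok|ek] := boolP (odd k); first by rewrite expr1 !mulN1r !subrr.
rewrite expr0 !mul1r.
have ek2 : k = (2 * k./2)%N :> nat.
  by rewrite mul2n -[LHS]odd_double_half (negbTE ek).
have H : y ^+ k <= z ^+ k.
  by rewrite ek2 (exprM y) (exprM z) lerXn2r// nnegrE sqr_ge0.
exact: lerD.
Qed.

(** By monotonicity in B, the extreme case B^2 = A D is enough; there the
    quadratics are the perfect squares of sqrt A + sqrt D x and
    sqrt A - sqrt D x, and the binomial formula applies. *)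
Lemma symmetrized_quadratic_le (n : nat) (A B D x : R) :
  0 <= A -> 0 <= D -> B ^+ 2 <= A * D ->
  (A + 2 * B * x + D * x ^+ 2) ^+ n + (A - 2 * B * x + D * x ^+ 2) ^+ n <=
  2 * \sum_(i < n.+1) (A ^+ (n - i) * D ^+ i * x ^+ i.*2) *+ 'C(n.*2, i.*2).
Proof.
move=> A0 D0 BAD.
pose a := Num.sqrt A; pose e := Num.sqrt D.
have aA : a ^+ 2 = A by rewrite sqr_sqrtr.
have eD : e ^+ 2 = D by rewrite sqr_sqrtr.
have X0 : 0 <= A + D * x ^+ 2 by rewrite addr_ge0// mulr_ge0// sqr_ge0.
have := @symmetrized_exprD_le n (A + D * x ^+ 2) (2 * B * x) (2 * a * e * x) X0.
have -> : A + D * x ^+ 2 + 2 * B * x = A + 2 * B * x + D * x ^+ 2 by ring.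
have -> : A + D * x ^+ 2 - 2 * B * x = A - 2 * B * x + D * x ^+ 2 by ring.
have -> : A + D * x ^+ 2 + 2 * a * e * x = (a + e * x) ^+ 2 by rewrite -aA -eD; ring.
have -> : A + D * x ^+ 2 - 2 * a * e * x = (a - e * x) ^+ 2 by rewrite -aA -eD; ring.
rewrite -[((a + e * x) ^+ 2) ^+ n]exprM -[((a - e * x) ^+ 2) ^+ n]exprM mul2n.
rewrite [(a + e * x) ^+ n.*2 + _]symmetrized_exprD => H.
apply: (le_trans (H _)).
  rewrite !exprMn aA eD -subr_ge0.
  have -> : 2 ^+ 2 * A * D * x ^+ 2 - 2 ^+ 2 * B ^+ 2 * x ^+ 2 =
    (A * D - B ^+ 2) * (2 * x) ^+ 2 by ring.
  by rewrite mulr_ge0 ?sqr_ge0// subr_ge0.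
rewrite (@sum_even_terms _ (fun k => (a ^+ (n.*2 - k) *
   ((e * x) ^+ k + (- (e * x)) ^+ k)) *+ 'C(n.*2, k))); last first.
  by move=> k ok; rewrite exprNn -signr_odd ok expr1 mulN1r subrr mulr0 mul0rn.
rewrite mulr_sumr; apply: ler_sum => i _.
rewrite exprNn -signr_odd odd_double expr0 mul1r -doubleB.
have exp2 (r : R) k : r ^+ k.*2 = (r ^+ 2) ^+ k by rewrite -mul2n exprM.
rewrite 3!exp2 aA (exprMn _ e x) eD (exprMn _ D).
by rewrite (mulrnAr 2) le_eqVlt; apply/orP; left; apply/eqP; congr (_ *+ _); ring.
Qed.

Lemma quadratic_ge0 (A B D x : R) :
  0 <= A -> 0 <= D -> B ^+ 2 <= A * D -> 0 <= A + 2 * B * x + D * x ^+ 2.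
Proof.
move=> A0 D0 BAD; have [D_eq0|DN0] := eqVneq D 0.
  move: BAD; rewrite D_eq0 mulr0 => B0.
  have /eqP : B ^+ 2 == 0 by rewrite eq_le B0 sqr_ge0.
  by move/eqP; rewrite sqrf_eq0 => /eqP ->; rewrite mulr0 !mul0r !addr0.
have Dp : 0 < D by rewrite lt_def DN0.
rewrite -(pmulr_rge0 _ Dp).
have -> : D * (A + 2 * B * x + D * x ^+ 2) = (D * x + B) ^+ 2 + (A * D - B ^+ 2).
  by ring.
by rewrite addr_ge0 ?sqr_ge0// subr_ge0.
Qed.

(** With A = |u|^2, B = <u, v>, D = |v|^2 this bounds the moment of order 2 n of
    |u + x v| for a Gaussian x by the n-th power of |u|^2 + (2 n - 1) s^2 |v|^2.
    The quadratic form is kept abstract so that A may also contain squares that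
    have already been integrated, which lets the inequality be iterated. Averaging
    over x and - x removes the odd moments. *)
Lemma gaussian_hypercontractivity (s : R) (n : nat) (A B D : R) : 0 < s ->
  0 <= A -> 0 <= D -> B ^+ 2 <= A * D ->
  (\int[normal_prob 0 s]_x ((A + 2 * B * x + D * x ^+ 2) ^+ n)%:E <=
   ((A + n.*2.-1%:R * s ^+ 2 * D) ^+ n)%:E)%E.
Proof.
move=> s0 A0 D0 BAD.
set gam := normal_prob 0 s.
pose f (x : R) := (A + 2 * B * x + D * x ^+ 2) ^+ n.
have mX k : measurable_fun setT (fun x : R => x ^+ k) by exact: measurable_funX.
have mf : measurable_fun setT f.
  apply: measurable_funX; apply: measurable_funD => /=; last exact: measurable_funM.
  by apply: measurable_funD => //; exact: measurable_funM.
have mfN : measurable_fun setT (fun x : R => f (- x)).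
  by apply: (measurableT_comp mf); exact: oppr_measurable.
have f0 x : 0 <= f x by rewrite exprn_ge0// quadratic_ge0.
have ev (k : nat) (x : R) : 0 <= x ^+ k.*2.
  by rewrite exprn_even_ge0// odd_double.
have c0 (k i : nat) : 0 <= (A ^+ (n - i) * D ^+ i) *+ k.
  by rewrite mulrn_wge0// mulr_ge0// exprn_ge0.
(* twice the integral, with one copy reflected *)
have Hsym : (\int[gam]_x (f x)%:E + \int[gam]_x (f x)%:E <=
  2%:E * ((A + n.*2.-1%:R * s ^+ 2 * D) ^+ n)%:E)%E.
  rewrite -{2}(integral_normal_prob_opp s0 f0 mf) -ge0_integralD//;
    try (by move=> x _; rewrite lee_fin); try exact/measurable_EFinP.
  apply: (@le_trans _ _ (\int[gam]_x (2%:E * \sum_(i < n.+1)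
      (((A ^+ (n - i) * D ^+ i) *+ 'C(n.*2, i.*2))%:E * (x ^+ i.*2)%:E)))%E).
    apply: ge0_le_integral => //.
    - by move=> x _; rewrite -EFinD lee_fin addr_ge0.
    - by apply: emeasurable_funD; exact/measurable_EFinP.
    - apply: emeasurable_funM => //; apply: emeasurable_sum => i.
      by apply: emeasurable_funM => //; exact/measurable_EFinP.
    - move=> x _; under eq_bigr do rewrite -EFinM.
      rewrite sumEFin -EFinM -EFinD lee_fin /f.
      apply: (le_trans _ (le_trans (symmetrized_quadratic_le n x A0 D0 BAD) _)).
        by rewrite sqrrN mulrN.
      rewrite ler_wpM2l// ler_sum// => i _.
      by rewrite mulrnAl.
  have mi (i : 'I_n.+1) : measurable_fun setT (fun x : R =>
      (((A ^+ (n - i) * D ^+ i) *+ 'C(n.*2, i.*2))%:E * (x ^+ i.*2)%:E)%E).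
    by apply: emeasurable_funM => //; exact/measurable_EFinP.
  rewrite ge0_integralZl//; last 2 first.
    by apply: emeasurable_sum.
    by move=> x _; rewrite sume_ge0// => i _; rewrite mule_ge0// lee_fin ?c0 ?ev.
  rewrite lee_wpmul2l ?lee_fin// ge0_integral_sum//; last first.
    by move=> i x _; rewrite mule_ge0// lee_fin ?c0 ?ev.
  rewrite exprDn -sumEFin lee_sum// => i _.
  rewrite ge0_integralZl//; last 3 first.
    exact/measurable_EFinP.
    by move=> x _; rewrite lee_fin.
    by rewrite lee_fin.
  apply: (@le_trans _ _ (((A ^+ (n - i) * D ^+ i) *+ 'C(n.*2, i.*2))%:E *
     (\prod_(j < i) (j.*2.+1%:R * s ^+ 2))%:E)%E).
    by rewrite lee_wpmul2l ?lee_fin//; exact: gaussian_moment_le.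
  rewrite -EFinM lee_fin big_split/= prodr_const card_ord.
  rewrite -natr_prod -(mulr_natr _ 'C(n.*2, i.*2)) -(mulr_natr _ 'C(n, i)).
  rewrite (exprMn _ _ D) (exprMn _ _ (s ^+ 2)) -natrX.
  have -> : A ^+ (n - i) * D ^+ i * 'C(n.*2, i.*2)%:R *
     ((\prod_(j < i) j.*2.+1)%:R * s ^+ 2 ^+ i) =
     (A ^+ (n - i) * D ^+ i * s ^+ 2 ^+ i) *
      ('C(n.*2, i.*2) * \prod_(j < i) j.*2.+1)%:R by rewrite natrM; ring.
  have -> : A ^+ (n - i) * ((n.*2.-1 ^ i)%:R * s ^+ 2 ^+ i * D ^+ i) *
     'C(n, i)%:R = (A ^+ (n - i) * D ^+ i * s ^+ 2 ^+ i) *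
      ('C(n, i) * n.*2.-1 ^ i)%:R by rewrite natrM; ring.
  rewrite ler_wpM2l//; first by rewrite !mulr_ge0 ?exprn_ge0 ?sqr_ge0// ltW.
  by rewrite ler_nat bin_double_le// -ltnS.
move: Hsym; rewrite -/f -mule2n -[(_ *+ 2)%E]mule_natl.
by rewrite lee_pmul2l// ?lte_fin.
Qed.

End Hypercontractivity.

(** * Integration against an independent variable *)

Section Independence.
Context {dO d2 : measure_display} {Omega : measurableType dO}
  {T2 : measurableType d2} {R : realType}.
Variable P : probability Omega R.
Variable Pi : set_system Omega.
Hypothesis Pi_measurable : Pi `<=` measurable.
Hypothesis PiI : setI_closed Pi.
Hypothesis PiT : Pi setT.
Variables (xi : Omega -> T2) (nu : probability T2 R).
Hypothesis mxi : measurable_fun setT xi.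
Hypothesis indep : forall S T, Pi S -> measurable T ->
  P (S `&` xi @^-1` T) = (P S * nu T)%E.

Local Notation G := (g_sigma_algebraType Pi).

(** Both sides are finite measures in S that agree on a pi-system. *)
Lemma independent_generated (S : set Omega) (T : set T2) :
  <<s Pi >> S -> measurable T -> P (S `&` xi @^-1` T) = (P S * nu T)%E.
Proof.
move=> sS mT.
have mD : measurable (xi @^-1` T) by rewrite -[X in measurable X]setTI; exact: mxi.
have nuf : nu T \is a fin_num by exact: fin_num_measure.
pose c : {nonneg R} := NngNum (fine_ge0 (measure_ge0 nu T)).
have cE : (c%:num)%:E = nu T by rewrite /= fineK.
have : mrestr P mD S = mscale c P S.
  apply: (@g_sigma_algebra_measure_unique _ R _ Pi Pi_measurable (fun=> setT)) => //.
  - by rewrite bigcup_const.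
  - move=> A PA; rewrite [LHS](indep PA mT) -cE muleC.
    by [].
  - by move=> _; rewrite -ge0_fin_numE//; exact: fin_num_measure.
by rewrite -cE muleC.
Qed.

Lemma generated_measurable (S : set Omega) : <<s Pi >> S -> measurable S.
Proof.
by apply: smallest_sub => //; exact: sigma_algebra_measurable.
Qed.

Lemma measurable_fun_generated d' (T' : measurableType d') (f : Omega -> T') :
  measurable_fun [set: G] (f : G -> T') -> measurable_fun setT f.
Proof.
by move=> mf _ Y mY; apply: generated_measurable; exact: mf.
Qed.

(** Integration of a function of an event space and of an independent variable: the
    joint law of the identity, seen with values in the coarser sigma-algebra, and
    of xi is a product measure, so Tonelli applies. Using the identity as first
    variable avoids choosing random variables that generate the sigma-algebra. *)
Lemma integral_independent (f : G * T2 -> \bar R) :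
  measurable_fun setT f -> (forall z, 0 <= f z)%E ->
  (\int[P]_w f (w : G, xi w) = \int[P]_w \int[nu]_x f (w : G, x))%E.
Proof.
move=> mf f0.
have mid : measurable_fun setT (fun w : Omega => (w : G)).
  by move=> _ Y mY; rewrite setTI; exact: generated_measurable.
have mpair : measurable_fun setT (fun w : Omega => (w : G, xi w)).
  exact: measurable_fun_pair.
pose X1 : {mfun Omega >-> G} := mfun_Sub (mem_set mid).
pose X2 : {mfun Omega >-> (G * T2)%type} := mfun_Sub (mem_set mpair).
pose m1 : probability G R := distribution P X1.
pose m' : probability (G * T2)%type R := distribution P X2.
have prod_eq A : measurable A -> (m1 \x nu)%E A = m' A.
  apply: product_measure_unique => {}A B mA mB.
  rewrite /m' /m1 /distribution /pushforward/=.
  rewrite -independent_generated//.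
have mF := measurable_fun_fubini_tonelli_F (m2 := nu) f mf f0.
transitivity (\int[m']_z f z)%E.
  by rewrite ge0_integral_distribution.
transitivity (\int[m1 \x nu]_z f z)%E.
  by apply: eq_measure_integral => A mA _; exact/esym/prod_eq.
rewrite fubini_tonelli1//.
rewrite ge0_integral_distribution// => w.
by apply: integral_ge0.
Qed.

End Independence.

(** * Moments of a Gaussian vector with random coefficients *)

Lemma cauchy_schwarz_sum {R : realDomainType} (I : finType) (a b : I -> R) :
  (\sum_i a i * b i) ^+ 2 <= (\sum_i a i ^+ 2) * (\sum_i b i ^+ 2).
Proof.
have H : 0 <= \sum_i \sum_j (a i * b j - a j * b i) ^+ 2.
  by apply: sumr_ge0 => i _; apply: sumr_ge0 => j _; exact: sqr_ge0.
have E : \sum_i \sum_j (a i * b j - a j * b i) ^+ 2 =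
   2 * ((\sum_i a i ^+ 2) * (\sum_i b i ^+ 2) - (\sum_i a i * b i) ^+ 2).
  pose p := (\sum_i a i ^+ 2) * (\sum_i b i ^+ 2).
  pose q := (\sum_i a i * b i) ^+ 2.
  have -> : 2 * (p - q) = p + p - 2 * q by ring.
  rewrite {2}/p [X in _ + X - _]mulrC /p /q expr2.
  rewrite !big_distrlr/= mulr_sumr -big_split/= -sumrB.
  apply: eq_bigr => i _; rewrite mulr_sumr -big_split/= -sumrB.
  by apply: eq_bigr => j _; ring.
by move: H; rewrite E pmulr_rge0// subr_ge0.
Qed.

Lemma measurable_sum_cond d (T : measurableType d) (R : realType) (D : set T)
    (I : Type) (r : seq I) (Q : pred I) (h : I -> T -> R) :
  (forall i, Q i -> measurable_fun D (h i)) ->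
  measurable_fun D (fun x => \sum_(i <- r | Q i) h i x).
Proof.
move=> mh; rewrite (_ : (fun x => _) =
    (fun x => \sum_(i <- r) (if Q i then h i x else 0))).
  by apply: measurable_sum => i; case: (Q i) (mh i) => // /(_ isT).
by apply/funext => x; rewrite big_mkcond.
Qed.

Section GaussianNoise.
Context {dO : measure_display} {Omega : measurableType dO} {R : realType}.
Variable P : probability Omega R.

(** Conditional form of the hypercontractive inequality: the coefficients of the
    quadratic are measurable for a sigma-algebra independent of xi, so they are
    constants for the inner integral. *)
Lemma gaussian_integral_independent_le (Pi : set_system Omega) (xi : Omega -> R)
    (s : R) (n : nat) (A B D : Omega -> R) :
  Pi `<=` measurable -> setI_closed Pi -> Pi setT ->
  measurable_fun setT xi ->
  (forall S T, Pi S -> measurable T ->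
    P (S `&` xi @^-1` T) = (P S * normal_prob 0 s T)%E) ->
  measurable_fun [set: g_sigma_algebraType Pi] A ->
  measurable_fun [set: g_sigma_algebraType Pi] B ->
  measurable_fun [set: g_sigma_algebraType Pi] D ->
  0 < s -> (forall w, 0 <= A w) -> (forall w, 0 <= D w) ->
  (forall w, B w ^+ 2 <= A w * D w) ->
  (\int[P]_w ((A w + 2 * B w * xi w + D w * xi w ^+ 2) ^+ n)%:E <=
   \int[P]_w ((A w + n.*2.-1%:R * s ^+ 2 * D w) ^+ n)%:E)%E.
Proof.
move=> PiM PiI PiT mxi indep mA mB mD s0 A0 D0 BAD.
pose G := g_sigma_algebraType Pi.
pose f (z : G * measurableTypeR R) : \bar R :=
  ((A z.1 + 2 * B z.1 * z.2 + D z.1 * z.2 ^+ 2) ^+ n)%:E.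
have m1 (g : G -> R) : measurable_fun setT g ->
    measurable_fun setT (fun z : G * measurableTypeR R => g z.1).
  by move=> mg; exact: (measurableT_comp mg measurable_fst).
have m2 : measurable_fun setT (fun z : G * measurableTypeR R => z.2) by exact: measurable_snd.
have mf : measurable_fun setT f.
  apply/measurable_EFinP/measurable_funX; apply: measurable_funD.
    apply: measurable_funD; first exact: m1.
    by apply: measurable_funM => //; apply: measurable_funM => //; exact: m1.
  by apply: measurable_funM; [exact: m1|exact: measurable_funX].
have f0 z : (0 <= f z)%E by rewrite lee_fin exprn_ge0// quadratic_ge0.
have mF := measurable_fun_fubini_tonelli_F (m2 := normal_prob 0 s) f mf f0.
have := integral_independent (T2 := measurableTypeR R) (nu := normal_prob 0 s) PiM PiI PiT mxi indep mf f0.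
rewrite {1}/f/= => ->.
apply: ge0_le_integral => //.
- by move=> w _; apply: integral_ge0.
- exact: (measurable_fun_generated PiM mF).
- apply/measurable_EFinP/measurable_funX; apply: measurable_funD.
    exact: (measurable_fun_generated PiM mA).
  by apply: measurable_funM => //; exact: (measurable_fun_generated PiM mD).
- move=> w _; have := @gaussian_hypercontractivity R s n (A w) (B w) (D w) s0 (A0 w) (D0 w) (BAD w).
  exact.
Qed.

Section Coordinates.
Variables (Pi0 : set_system Omega) (m : nat) (X : 'I_m -> Omega -> R) (s : R).
Hypothesis Pi0M : Pi0 `<=` measurable.
Hypothesis Pi0I : setI_closed Pi0.
Hypothesis Pi0T : Pi0 setT.
Hypothesis s0 : 0 < s.
Hypothesis mX : forall i, measurable_fun setT (X i).
Hypothesis indep : forall S (B : 'I_m -> set R), Pi0 S ->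
  (forall i, measurable (B i)) ->
  P (S `&` [set w | forall i, B i (X i w)]) =
    (P S * \prod_(i < m) normal_prob 0 s (B i))%E.

(** Events of the past intersected with conditions on the first l coordinates of
    the noise. This pi-system generates the sigma-algebra of which coordinate l is
    independent. *)
Definition past_and_coordinates (l : nat) : set_system Omega :=
  [set A | exists S (B : 'I_m -> set R), [/\ Pi0 S, forall i, measurable (B i),
     forall i : 'I_m, (l <= i)%N -> B i = setT &
     A = S `&` [set w | forall i, B i (X i w)]]].

Lemma measurable_box (B : 'I_m -> set R) : (forall i, measurable (B i)) ->
  measurable [set w | forall i, B i (X i w)].
Proof.
move=> mB; rewrite (_ : [set w | _] = \bigcap_(i in [set: 'I_m]) (X i @^-1` B i)).
  apply: fin_bigcap_measurable => // i _.
  by rewrite -[X in measurable X]setTI; exact: mX.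
by apply/seteqP; split=> w /= H i; [move=> _|]; apply: H.
Qed.

Lemma past_and_coordinates_measurable l : past_and_coordinates l `<=` measurable.
Proof.
move=> _ [S [B [PS mB _ ->]]]; apply: measurableI; first exact: Pi0M.
exact: measurable_box.
Qed.

Lemma past_and_coordinatesI l : setI_closed (past_and_coordinates l).
Proof.
move=> _ _ [S [B [PS mB lB ->]]] [S' [B' [PS' mB' lB' ->]]].
exists (S `&` S'), (fun i => B i `&` B' i); split.
- exact: Pi0I.
- by move=> i; exact: measurableI.
- by move=> i li; rewrite lB// lB'// setTI.
- rewrite setIACA; congr (_ `&` _); apply/seteqP; split=> w /=.
    by move=> [h1 h2] i.
  by move=> h; split=> i; have [] := h i.
Qed.

Lemma past_and_coordinates_past l S : Pi0 S -> past_and_coordinates l S.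
Proof.
move=> PS; exists S, (fun=> setT); split=> //.
by rewrite [X in S `&` X](_ : _ = setT) ?setIT//; apply/seteqP; split.
Qed.

Lemma past_and_coordinates_indep (l : 'I_m) S T :
  past_and_coordinates l S -> measurable T ->
  P (S `&` X l @^-1` T) = (P S * normal_prob 0 s T)%E.
Proof.
move=> [S0 [B [PS mB lB ->]]] mT.
pose B' i := if i == l then T else B i.
have -> : S0 `&` [set w | forall i, B i (X i w)] `&` X l @^-1` T =
    S0 `&` [set w | forall i, B' i (X i w)].
  rewrite -setIA; congr (_ `&` _); apply/seteqP; split=> w /=.
    by move=> [h1 h2] i; rewrite /B'; case: eqP => // ->.
  move=> h; split=> [i|]; last by have := h l; rewrite /B' eqxx.
  by have := h i; rewrite /B'; case: eqP => // -> _; rewrite lB.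
rewrite !indep//; last by move=> i; rewrite /B'; case: eqP.
rewrite (bigD1 l)//= [in RHS](bigD1 l)//= lB// probability_setT mul1e.
rewrite /B' eqxx -muleA; congr (_ * _)%E; rewrite muleC; congr (_ * _)%E.
by apply: eq_bigr => i /negbTE ->.
Qed.

Lemma measurable_fun_past l d' (T' : measurableType d') (f : Omega -> T') :
  measurable_fun [set: g_sigma_algebraType Pi0] f ->
  measurable_fun [set: g_sigma_algebraType (past_and_coordinates l)] f.
Proof.
move=> mf mT Y mY; have := mf measurableT Y mY; rewrite !setTI.
apply: smallest_sub; first exact: smallest_sigma_algebra.
by move=> S PS; apply: sub_sigma_algebra; exact: past_and_coordinates_past.
Qed.

Lemma measurable_fun_coordinate (l : nat) (i : 'I_m) : (i < l)%N ->
  measurable_fun [set: g_sigma_algebraType (past_and_coordinates l)] (X i).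
Proof.
move=> il _ Y mY; rewrite setTI; apply: sub_sigma_algebra.
exists setT, (fun k => if k == i then Y else setT); split=> //.
- by move=> k; case: eqP.
- by move=> k lk; case: eqP => // ki; rewrite -ki ltnNge lk in il.
- rewrite setTI; apply/seteqP; split=> w /=.
    by move=> h k; case: eqP => // ->.
  by move=> /(_ i); rewrite eqxx.
Qed.

(** The coordinates of the noise are integrated out one at a time, the last one
    first: [T l] is the expression in which the coordinates from l on have been
    replaced by their variance times the hypercontractive constant. *)
Section LinearNoise.
Variables (d n : nat) (u : 'I_d -> Omega -> R) (a : 'I_d -> 'I_m -> Omega -> R).
Local Notation G0 := (g_sigma_algebraType Pi0).
Hypothesis mu : forall j, measurable_fun [set: G0] (u j).
Hypothesis ma : forall j i, measurable_fun [set: G0] (a j i).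
Let c := n.*2.-1%:R * s ^+ 2.
Let v l j w := u j w + \sum_(i < m | (i < l)%N) a j i w * X i w.
Let T l w := \sum_j v l j w ^+ 2
  + c * \sum_(i < m | (l <= i)%N) \sum_j a j i w ^+ 2.

Let T_step l : (l < m)%N ->
  (\int[P]_w (T l.+1 w ^+ n)%:E <= \int[P]_w (T l w ^+ n)%:E)%E.
Proof.
move=> lm; pose i0 := Ordinal lm.
pose A w := \sum_j v l j w ^+ 2
  + c * \sum_(i < m | (l.+1 <= i)%N) \sum_j a j i w ^+ 2.
pose B w := \sum_j v l j w * a j i0 w.
pose D w := \sum_j a j i0 w ^+ 2.
have c0 : 0 <= c by rewrite mulr_ge0// sqr_ge0.
have D0 w : 0 <= D w by apply: sumr_ge0 => j _; exact: sqr_ge0.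
have v0 w : 0 <= \sum_j v l j w ^+ 2.
  by apply: sumr_ge0 => j _; exact: sqr_ge0.
have vA w : \sum_j v l j w ^+ 2 <= A w.
  rewrite lerDl mulr_ge0// sumr_ge0// => i _.
  by apply: sumr_ge0 => j _; exact: sqr_ge0.
have Tl w : T l w = A w + n.*2.-1%:R * s ^+ 2 * D w.
  rewrite /T /A -addrA; congr (_ + _); rewrite -/c -mulrDr; congr (_ * _).
  rewrite (bigD1 i0)//= addrC; congr (_ + _); apply: eq_bigl => i.
  by rewrite ltn_neqAle andbC; congr (_ && _); rewrite -val_eqE/= eq_sym.
have TSl w : T l.+1 w = A w + 2 * B w * X i0 w + D w * X i0 w ^+ 2.
  have vS j : v l.+1 j w = v l j w + a j i0 w * X i0 w.
    rewrite /v (bigD1 i0)//= addrA addrAC; congr (_ + _ + _).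
    apply: eq_bigl => i; rewrite ltnS [RHS]ltn_neqAle andbC; congr (_ && _).
  rewrite /T (eq_bigr (fun j => v l j w ^+ 2 +
      (2 * X i0 w) * (v l j w * a j i0 w) + X i0 w ^+ 2 * a j i0 w ^+ 2)); last first.
    by move=> j _; rewrite vS; ring.
  rewrite !big_split/= -!mulr_sumr -/(B w) -/(D w) /A; ring.
under eq_integral do rewrite TSl.
under [X in (_ <= X)%E]eq_integral do rewrite Tl.
have mv j : measurable_fun [set: g_sigma_algebraType (past_and_coordinates l)]
    (v l j).
  apply: measurable_funD; first by apply: measurable_fun_past.
  apply: measurable_sum_cond => i il.
  by apply: measurable_funM;
    [by apply: measurable_fun_past|exact: measurable_fun_coordinate].
have maa j i : measurable_fun
    [set: g_sigma_algebraType (past_and_coordinates l)] (a j i).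
  by apply: measurable_fun_past.
apply: (@gaussian_integral_independent_le (past_and_coordinates l)) => //.
- exact: past_and_coordinates_measurable.
- exact: past_and_coordinatesI.
- exact: past_and_coordinates_past.
- by move=> S Y; exact: (@past_and_coordinates_indep i0).
- apply: measurable_funD; first by apply: measurable_sum => j; exact: measurable_funX.
  apply: measurable_funM => //; apply: measurable_sum_cond => i il.
  by apply: measurable_sum => j; exact: measurable_funX.
- by apply: measurable_sum => j; exact: measurable_funM.
- by apply: measurable_sum => j; exact: measurable_funX.
- by move=> w; rewrite (le_trans _ (vA w)).
- move=> w; apply: (le_trans (cauchy_schwarz_sum _ _)).
  by apply: ler_wpM2r; [exact: D0|exact: vA].
Qed.

(** The moment of order 2 n of |u + a X| is at most the n-th moment of
    |u|^2 + (2 n - 1) s^2 ||a||^2, without remainder, so that the coercivity condition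
    can absorb the second term. *)
Lemma gaussian_noise_moment_le :
  (\int[P]_w ((\sum_j (u j w + \sum_i a j i w * X i w) ^+ 2) ^+ n)%:E <=
   \int[P]_w ((\sum_j u j w ^+ 2 + n.*2.-1%:R * s ^+ 2 *
      \sum_i \sum_j a j i w ^+ 2) ^+ n)%:E)%E.
Proof.
have H l : (l <= m)%N ->
    (\int[P]_w (T l w ^+ n)%:E <= \int[P]_w (T 0%N w ^+ n)%:E)%E.
  elim: l => [|l IH] lm //.
  by apply: (le_trans (T_step lm)); exact: IH (ltnW lm).
have := H m (leqnn m).
have -> : (\int[P]_w (T m w ^+ n)%:E =
    \int[P]_w ((\sum_j (u j w + \sum_i a j i w * X i w) ^+ 2) ^+ n)%:E)%E.
  apply: eq_integral => w _; congr ((_ ^+ _)%:E); rewrite /T.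
  rewrite [X in _ + _ * X]big1 ?mulr0 ?addr0; last first.
    by move=> i; rewrite leqNgt ltn_ord.
  apply: eq_bigr => j _; congr ((_ + _) ^+ 2).
  by apply: eq_bigl => i; rewrite ltn_ord.
have -> // : (\int[P]_w (T 0%N w ^+ n)%:E =
   \int[P]_w ((\sum_j u j w ^+ 2 + n.*2.-1%:R * s ^+ 2 *
      \sum_i \sum_j a j i w ^+ 2) ^+ n)%:E)%E.
apply: eq_integral => w _; congr ((_ ^+ _)%:E); rewrite /T; congr (_ + _).
by apply: eq_bigr => j _; rewrite /v big_pred0 ?addr0.
Qed.

End LinearNoise.

End Coordinates.

End GaussianNoise.

(** * The past of the copies and their increments *)

Lemma measurable_coordB dT (T : measurableType dT) (R : realType) (m : nat)
    (f g : T -> 'cV[R]_m) (i : 'I_m) :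
  measurable_fun setT f -> measurable_fun setT g ->
  measurable_fun setT (fun z => (f z - g z) i ord0).
Proof.
move=> mf mg; under eq_fun do rewrite !mxE.
by apply: measurable_funB; exact: (measurableT_comp (@measurable_coord R m i)).
Qed.

Section PastOfCopies.
Context {dO : measure_display} {Omega : measurableType dO} {R : realType}.
Variable P : probability Omega R.
Variables (Ft : R -> set_system Omega) (d m N : nat).
Variables (W : R -> Omega -> 'cV[R]_m) (X0 : Omega -> 'cV[R]_d).
Variables (Wc : 'I_N -> R -> Omega -> 'cV[R]_m) (X0c : 'I_N -> Omega -> 'cV[R]_d).
Hypothesis hFt : complete_filtration P Ft.
Hypothesis hW : brownian_motion P Ft W.
Hypothesis hX0 : adapted_to (Ft 0) X0.
Hypothesis hiid : iid_copies P W X0 Wc X0c.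

Local Notation path := ((R -> 'cV[R]_m) * 'cV[R]_d)%type.

Definition path_generators (s : R) : set_system path :=
  [set A | (exists t B, [/\ 0 <= t, t <= s, measurable B &
                  A = [set z : path | B (z.1 t)]])
             \/ (exists2 B, measurable B & A = [set z : path | B z.2])].

Let all_path_generators : set_system path :=
  [set A | (exists t B, [/\ 0 <= t, measurable B &
                  A = [set z : path | B (z.1 t)]])
             \/ (exists2 B, measurable B & A = [set z : path | B z.2])].

Definition path_events_upto (s : R) : set_system path := <<s path_generators s >>.

(** The pi-system of cylinders over the N copies, each constrained up to time s; it
    generates the sigma-algebra of all the initial values and of all the noises up
    to time s. *)
Definition copies_past (s : R) : set_system Omega :=
  [set S | exists A : 'I_N -> set path, (forall i, path_events_upto s (A i)) /\
     S = \bigcap_(i in [set: 'I_N]) (fun w => (Wc i ^~ w, X0c i w)) @^-1` A i].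

Lemma path_events_upto_sub s : path_events_upto s `<=` @path_events R m d.
Proof.
apply: smallest_sub; first exact: smallest_sigma_algebra.
move=> A [[t [B [t0 ts mB ->]]]|[B mB ->]]; apply: sub_sigma_algebra.
  by left; exists t, B.
by right; exists B.
Qed.

Lemma copies_past_measurable s : copies_past s `<=` measurable.
Proof.
move=> _ [A [HA ->]]; apply: fin_bigcap_measurable => // i _.
by have [mxi _ _] := hiid; apply: mxi; exact: path_events_upto_sub.
Qed.

Lemma copies_pastI s : setI_closed (copies_past s).
Proof.
move=> _ _ [A [HA ->]] [A' [HA' ->]].
exists (fun i => A i `&` A' i); split.
  by move=> i; exact: (@measurableI _ (g_sigma_algebraType (path_generators s)) _ _ (HA i) (HA' i)).
rewrite -bigcapI; apply: eq_bigcapr => i _; by rewrite preimage_setI.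
Qed.

Lemma copies_pastT s : copies_past s setT.
Proof.
exists (fun=> setT); split.
  by move=> i; exact: (@measurableT _ (g_sigma_algebraType (path_generators s))).
by apply/seteqP; split.
Qed.

Let copies_past_one s (i : 'I_N) (A : set path) : path_events_upto s A ->
  copies_past s ((fun w => (Wc i ^~ w, X0c i w)) @^-1` A).
Proof.
move=> HA; exists (fun k => if k == i then A else setT); split.
  move=> k; case: eqP => // _.
  exact: (@measurableT _ (g_sigma_algebraType (path_generators s))).
apply/seteqP; split=> w /=.
  by move=> h k _; case: eqP => // ->.
by move=> /(_ i Logic.I); rewrite eqxx.
Qed.

Lemma measurable_fun_initial s i :
  measurable_fun [set: g_sigma_algebraType (copies_past s)] (X0c i).
Proof.
move=> _ B mB; rewrite setTI; apply: sub_sigma_algebra.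
apply: (@copies_past_one s i [set z : path | B z.2]).
by apply: sub_sigma_algebra; right; exists B.
Qed.

Lemma measurable_fun_noise s r i : 0 <= r -> r <= s ->
  measurable_fun [set: g_sigma_algebraType (copies_past s)] (Wc i r).
Proof.
move=> r0 rs _ B mB; rewrite setTI; apply: sub_sigma_algebra.
apply: (@copies_past_one s i [set z : path | B (z.1 r)]).
by apply: sub_sigma_algebra; left; exists r, B.
Qed.

Let increment_box (s t : R) (B : 'I_m -> set R) : 0 <= s -> 0 <= t ->
  (forall i, measurable (B i)) ->
  @path_events R m d [set z : path | forall i, B i ((z.1 t - z.1 s) i ord0)].
Proof.
move=> s0 t0 mB.
pose T := g_sigma_algebraType all_path_generators.
have mev r : 0 <= r -> measurable_fun [set: T] (fun z : T => z.1 r).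
  move=> r0 _ Y mY; rewrite setTI; apply: sub_sigma_algebra.
  by left; exists r, Y.
have := @measurable_box _ T R m (fun i (z : T) => (z.1 t - z.1 s) i ord0).
by apply => // i; apply: measurable_coordB; exact: mev.
Qed.

Lemma measurable_increment s t j (i : 'I_m) : 0 <= s -> 0 <= t ->
  measurable_fun setT (fun w => (Wc j t w - Wc j s w) i ord0).
Proof.
move=> s0 t0 _ Y mY; rewrite setTI.
have [mxi _ _] := hiid.
have := mxi j _ (@increment_box s t (fun k => if k == i then Y else setT) s0 t0 _).
rewrite (_ : _ @^-1` _ = (fun w => (Wc j t w - Wc j s w) i ord0) @^-1` Y).
  by apply=> k; case: eqP.
apply/seteqP; split=> w /=; first by move=> /(_ i); rewrite eqxx.
by move=> h k; case: eqP => // ->.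
Qed.

Let past_in_filtration s A : 0 <= s -> path_events_upto s A ->
  Ft s ((fun w => (W ^~ w, X0 w)) @^-1` A).
Proof.
move=> s0 HA.
have [_ sFt mon _] := hFt; have [_ _ adW _ _] := hW.
have [sas _] := sFt s s0.
have := sigma_algebra_image (fun w => (W ^~ w, X0 w)) sas.
set H := image_set_system _ _ _ => saH.
suff /(_ A HA) : path_events_upto s `<=` H by rewrite /H/image_set_system/= setTI.
apply: smallest_sub => //.
move=> _ [[t [B [t0 ts mB ->]]]|[B mB ->]]; rewrite /H/image_set_system/= setTI.
  by apply: (mon t s t0 ts); exact: adW.
by apply: (mon 0 s) => //; exact: hX0.
Qed.

(** Mutual independence splits the probability into one factor per copy; only
    copy j feels the increment. Its law is that of (W, X_0), for which the past up
    to s lies in the filtration at time s, of which the increment is independent. *)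
Lemma copies_increment_indep s t j S (B : 'I_m -> set R) : 0 <= s -> s < t ->
  copies_past s S -> (forall i, measurable (B i)) ->
  P (S `&` [set w | forall i, B i ((Wc j t w - Wc j s w) i ord0)]) =
  (P S * \prod_(i < m) normal_prob 0 (Num.sqrt (t - s)) (B i))%E.
Proof.
move=> s0 st [A [HA ->]] mB.
have t0 : 0 <= t by rewrite (le_trans s0)// ltW.
have [mxi eqxi prodxi] := hiid.
pose E := [set z : path | forall i, B i ((z.1 t - z.1 s) i ord0)].
have pE : @path_events R m d E by exact: increment_box.
have pA i : @path_events R m d (A i) by exact: path_events_upto_sub.
have pAE i : @path_events R m d (A i `&` E).
  exact: (@measurableI _ (g_sigma_algebraType all_path_generators) _ _ (pA i) pE).
pose A' i := if i == j then A i `&` E else A i.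
have -> : \bigcap_(i in [set: 'I_N]) (fun w => (Wc i ^~ w, X0c i w)) @^-1` A i
   `&` [set w | forall i, B i ((Wc j t w - Wc j s w) i ord0)] =
   \bigcap_(i in [set` [set: 'I_N]%SET]) (fun w => (Wc i ^~ w, X0c i w)) @^-1` A' i.
  apply/seteqP; split=> w /=.
    move=> [h1 h2] i _; rewrite /A'; case: eqP => [->|_]; last exact: h1.
    by split; [exact: h1|exact: h2].
  move=> h; split.
    move=> i _; have := h i (finset.in_setT i).
    by rewrite /A'; case: eqP => // _ [].
  by have := h j (finset.in_setT j); rewrite /A' eqxx => -[].
have -> : \bigcap_(i in [set: 'I_N]) (fun w => (Wc i ^~ w, X0c i w)) @^-1` A i =
   \bigcap_(i in [set` [set: 'I_N]%SET]) (fun w => (Wc i ^~ w, X0c i w)) @^-1` A i.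
  by rewrite (_ : [set` _] = setT)//; apply/seteqP; split=> i //= _; exact: finset.in_setT.
rewrite !prodxi//; last by move=> i; rewrite /A'; case: eqP.
rewrite (bigD1 j (finset.in_setT j))/= [in RHS](bigD1 j (finset.in_setT j))/=.
rewrite {1}/A' eqxx !eqxi//.
have -> : (P ((fun w => (W ^~ w, X0 w)) @^-1` (A j `&` E)) =
   P ((fun w => (W ^~ w, X0 w)) @^-1` A j) *
    \prod_(i < m) normal_prob 0 (Num.sqrt (t - s)) (B i))%E.
  have [_ _ _ indW gaussW] := hW.
  rewrite preimage_setI -(gaussW s t s0 st B mB); apply: (indW s t s0 st).
    exact: (past_in_filtration s0 (HA j)).
  exists [set v : 'cV[R]_m | forall i, B i (v i ord0)].
    by apply: measurable_box => // i; exact: measurable_coord.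
  by rewrite setTI.
rewrite muleAC; congr (_ * _ * _)%E; apply: eq_bigr => i /andP[_ ij].
by rewrite /A' (negbTE ij).
Qed.

Lemma copies_same_law j (B : set 'cV[R]_d) : measurable B ->
  P (X0c j @^-1` B) = P (X0 @^-1` B).
Proof.
move=> mB; have [_ eqxi _] := hiid.
have := eqxi j [set z : path | B z.2]; apply.
by apply: sub_sigma_algebra; right; exists B.
Qed.

Lemma measurable_initial_copy j : measurable_fun setT (X0c j).
Proof.
move=> _ Y mY; rewrite setTI; have [mxi _ _] := hiid.
have := mxi j [set z : path | Y z.2]; apply.
by apply: sub_sigma_algebra; right; exists Y.
Qed.

End PastOfCopies.

(** * Measurability of matrix-valued maps *)

Section MatrixMeasurability.
Context {R : realType}.

Lemma ratr_matrix_approx (p q : nat) (A : 'M[R]_(p, q)) (e : R) : 0 < e ->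
  exists Q : 'M[rat]_(p, q), forall i j, `|A i j - ratr (Q i j)| < e.
Proof.
move=> e0.
have /choice[f Hf] : forall ij : 'I_p * 'I_q,
    exists r : rat, `|A ij.1 ij.2 - ratr r| < e.
  move=> [i j] /=.
  have /rat_in_itvoo[r] : A i j - e < A i j + e by lra.
  rewrite in_itv/= => /andP[h1 h2]; exists r; rewrite ltr_norml.
  by apply/andP; split; lra.
by exists (\matrix_(i, j) f (i, j)) => i j; rewrite mxE; exact: (Hf (i, j)).
Qed.

(** An open set of matrices is a countable union of cubes with rational centres,
    so the Borel sigma-algebra is generated by the entries. *)
Lemma measurable_matrix dT (T : measurableType dT) (p q : nat)
    (Z : T -> 'M[R]_(p, q)) :
  (forall i j, measurable_fun setT (fun w => Z w i j)) -> measurable_fun setT Z.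
Proof.
move=> mZ.
apply: (@measurability _ _ _ _ _ _ (@open 'M[R]_(p, q))) => //.
move=> _ [U oU <-]; rewrite setTI.
pose cube (Q : 'M[rat]_(p, q)) (n : nat) : set 'M[R]_(p, q) :=
  [set A | forall i j, `|A i j - ratr (Q i j)| < n.+1%:R^-1].
pose F (k : nat) : set T := if unpickle k is Some (Q, n) then
  (if pselect (cube Q n `<=` U) then Z @^-1` cube Q n else set0) else set0.
have -> : Z @^-1` U = \bigcup_k F k.
  apply/seteqP; split=> w /=; last first.
    move=> [k _]; rewrite /F; case: (unpickle k) => [[Q n]|//].
    by case: pselect => // h /h.
  move=> UZ; have /nbhs_ballP[e e0 He] : nbhs (Z w) U by exact: open_nbhs_nbhs.
  have [n ne] : exists n : nat, n.+1%:R^-1 < e / 2.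
    have := near_infty_natSinv_lt (PosNum (divr_gt0 e0 (ltr0n _ 2))).
    by move=> [n _ H]; exists n; apply: H => /=.
  have [Q HQ] := @ratr_matrix_approx p q (Z w) n.+1%:R^-1 ltac:(by rewrite invr_gt0).
  exists (pickle (Q, n)) => //; rewrite /F pickleK.
  case: pselect => // -[] A HA; apply: He; split=> // i j.
  rewrite /ball/=; have := HQ i j; have := HA i j.
  rewrite -[Z w i j - A i j](subrKA (ratr (Q i j))) => h1 h2.
  apply: (le_lt_trans (ler_normD _ _)).
  rewrite [`|ratr _ - _|]distrC [ltRHS]splitr.
  by apply: ltrD; [exact: lt_trans h2 ne|exact: lt_trans h1 ne].
apply: bigcup_measurable => k _; rewrite /F; case: unpickle => [[Q n]|//].
case: pselect => [h|h] //=.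
rewrite (_ : Z @^-1` _ = \bigcap_(ij in [set: 'I_p * 'I_q])
   (fun w => Z w ij.1 ij.2) @^-1` [set x | `|x - ratr (Q ij.1 ij.2)| < n.+1%:R^-1]).
  apply: fin_bigcap_measurable => // -[i j] _ /=.
  rewrite -[X in measurable X]setTI; apply: mZ => //.
  rewrite (_ : [set x | _] = ball (ratr (Q i j) : R) n.+1%:R^-1).
    exact: measurable_ball.
  by apply/seteqP; split=> x /=; rewrite /ball/= distrC.
apply/seteqP; split=> w /=; first by move=> H [i j] _; exact: H.
by move=> H i j; exact: (H (i, j)).
Qed.

Lemma measurable_continuous_comp dT (T : measurableType dT) (p q : nat)
    (Z : T -> 'M[R]_(p, q)) (f : 'M[R]_(p, q) -> R) :
  continuous f -> measurable_fun setT Z -> measurable_fun setT (f \o Z).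
Proof.
move=> /continuousP cf mZ; apply: measurableT_comp => //.
apply: (measurability _ (RGenOpens.measurableE R)).
move=> _ [_ [a [b ->] <-]]; rewrite setTI; apply: sub_sigma_algebra => /=.
by apply: cf; exact: interval_open.
Qed.

(** Squared form of local Lipschitz continuity, the form in which the hypotheses on
    the coefficients bound their increments. *)
Lemma continuous_of_local_lipschitz (p q : nat) (f : 'M[R]_(p, q) -> R) :
  (forall Z : 'M[R]_(p, q), exists2 K : R, 0 <= K &
    forall (Z' : 'M[R]_(p, q)) (e : R), 0 < e -> e <= 1 ->
    (forall i j, `|Z i j - Z' i j| <= e) -> (f Z - f Z') ^+ 2 <= K * e ^+ 2) ->
  continuous f.
Proof.
move=> lf Z U /nbhs_ballP[e /= e0 HU].
have [K K0 HK] := lf Z.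
pose t := Num.min 1 (e / (1 + K)).
have K1 : 0 < 1 + K by lra.
have t0 : 0 < t by rewrite lt_min ltr01 divr_gt0.
have te : t * (1 + K) <= e by rewrite -ler_pdivlMr// ge_min lexx orbT.
apply/nbhs_ballP; exists t => //= Z' [_ ZZ']; apply: HU; rewrite /ball/=.
have := HK Z' t t0 ltac:(by rewrite ge_min lexx) _.
have H i j : `|Z i j - Z' i j| <= t by apply/ltW; exact: ZZ'.
move=> /(_ H) {}HK.
suff : (f Z - f Z') ^+ 2 < e ^+ 2.
  by rewrite -[X in X < _]real_normK ?num_real// ltr_pXn2r// nnegrE// ltW.
apply: (le_lt_trans HK).
have : K * t ^+ 2 < (t * (1 + K)) ^+ 2.
  have := exprn_gt0 2 t0; set u := t ^+ 2 => u0.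
  have -> : (t * (1 + K)) ^+ 2 = u * (1 + K) ^+ 2 by rewrite /u; ring.
  rewrite mulrC ltr_pM2l//; have := sqr_ge0 K; nra.
move=> /lt_le_trans; apply.
by rewrite lerXn2r// nnegrE ltW// mulr_gt0.
Qed.

End MatrixMeasurability.

(** * Empirical measures and the Wasserstein distance *)

Section UniformAtoms.
Context {d} {T : measurableType d} {R : realType}.
Variables (N : nat) (N_gt0 : (0 < N)%N) (z : 'I_N -> T).

Let z' (k : nat) : T := if insub k is Some i then z i else z (Ordinal N_gt0).
Let mz : {measure set T -> \bar R} := mscale ((N%:R^-1)%:nng : {nonneg R})
  (msum (fun k => \d_(z' k) : {measure set T -> \bar R}) N).

Let mzE A : mz A = ((N%:R^-1)%:E * \sum_(i < N) \d_(z i) A)%E.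
Proof.
rewrite /mz /mscale/= /msum/=; congr (_ * _)%E.
by apply: eq_bigr => i _; rewrite /z' valK.
Qed.

Let mzT : mz setT = 1%E.
Proof.
rewrite mzE; under eq_bigr do rewrite diracT.
rewrite sumEFin sumr_const card_ord -EFinM mulVf//.
by rewrite pnatr_eq0 -lt0n.
Qed.

Definition uniform_atoms : probability T R :=
  HB.pack (mz : set T -> \bar R) mz (Measure_isProbability.Build _ _ _ mz mzT).

Lemma uniform_atomsE A :
  uniform_atoms A = ((N%:R^-1)%:E * \sum_(i < N) \d_(z i) A)%E.
Proof. exact: mzE. Qed.

Lemma integral_uniform_atoms (f : T -> R) : measurable_fun setT f ->
  (forall x, 0 <= f x) ->
  (\int[uniform_atoms]_x (f x)%:E = (N%:R^-1 * \sum_i f (z i))%:E)%E.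
Proof.
move=> mf f0; have mfE : measurable_fun setT (EFin \o f) by exact/measurable_EFinP.
transitivity (\int[mz]_x (f x)%:E)%E; first by apply: eq_measure_integral.
rewrite ge0_integral_mscale//; last by move=> x _; rewrite lee_fin.
rewrite ge0_integral_measure_sum//; last by move=> x _; rewrite lee_fin.
under eq_bigr do rewrite integral_dirac// diracT mul1e.
rewrite sumEFin -EFinM/=; congr (_ * _)%:E.
by apply: eq_bigr => i _; rewrite /z' valK.
Qed.

End UniformAtoms.

Section EmpiricalMeasures.
Context {R : realType} {d : nat}.
Implicit Types x y : 'cV[R]_d.

Lemma enorm_ge0 x : 0 <= enorm x. Proof. exact: sqrtr_ge0. Qed.

Lemma enorm_sqrE x : enorm x ^+ 2 = \sum_i x i ord0 ^+ 2.
Proof. by rewrite enorm_sqr; apply: eq_bigr => i _; rewrite expr2. Qed.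

Lemma hsnorm_sqrE (m : nat) (B : 'M[R]_(d, m)) :
  hsnorm B ^+ 2 = \sum_i \sum_j B i j ^+ 2.
Proof.
have E : \tr (B *m B^T) = \sum_i \sum_j B i j ^+ 2.
  apply: eq_bigr => i _; rewrite !mxE; apply: eq_bigr => j _.
  by rewrite !mxE expr2.
rewrite /hsnorm E sqr_sqrtr//.
by apply: sumr_ge0 => i _; apply: sumr_ge0 => j _; exact: sqr_ge0.
Qed.

Lemma dotDl x y w : dot (x + y) w = dot x w + dot y w.
Proof.
by rewrite /dot -big_split/=; apply: eq_bigr => i _; rewrite !mxE mulrDl.
Qed.

Lemma dotC x y : dot x y = dot y x.
Proof. by apply: eq_bigr => i _; rewrite mulrC. Qed.

Lemma dotNl x y : dot (- x) y = - dot x y.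
Proof.
by rewrite /dot -sumrN; apply: eq_bigr => i _; rewrite !mxE mulNr.
Qed.

Lemma dotZl (c : R) x y : dot (c *: x) y = c * dot x y.
Proof.
by rewrite /dot mulr_sumr; apply: eq_bigr => i _; rewrite !mxE mulrA.
Qed.

Lemma enorm_sqrD x y :
  enorm (x + y) ^+ 2 = enorm x ^+ 2 + 2 * dot x y + enorm y ^+ 2.
Proof. by rewrite !enorm_sqr dotDl ![dot _ (x + y)]dotC !dotDl (dotC y x); ring. Qed.

Lemma enormN x : enorm (- x) = enorm x.
Proof. by rewrite /enorm dotNl dotC dotNl opprK. Qed.

Lemma enorm0 : enorm (0 : 'cV[R]_d) = 0.
Proof. by rewrite /enorm /dot big1 ?sqrtr0// => i _; rewrite !mxE mulr0. Qed.

Lemma dot_le x y : 2 * `|dot x y| <= enorm x ^+ 2 + enorm y ^+ 2.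
Proof.
have := sqr_ge0 (enorm (x + y)); have := sqr_ge0 (enorm (x - y)).
rewrite !enorm_sqrD enormN (dotC x (- y)) dotNl (dotC y x) => h1 h2.
by case: (ger0P (dot x y)) => h3; lra.
Qed.

Lemma enorm_sqrD_le x y : enorm (x + y) ^+ 2 <= 2 * enorm x ^+ 2 + 2 * enorm y ^+ 2.
Proof.
rewrite enorm_sqrD; have h1 := dot_le x y; have h2 := ler_norm (dot x y); lra.
Qed.

Lemma measurable_enorm_sub_sqr :
  measurable_fun setT (fun z : 'cV[R]_d * 'cV[R]_d => enorm (z.1 - z.2) ^+ 2).
Proof.
under eq_fun do rewrite enorm_sqrE.
apply: measurable_sum => i; apply: measurable_funX.
by apply: measurable_coordB; [exact: measurable_fst|exact: measurable_snd].
Qed.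

Lemma measurable_enorm : measurable_fun setT (fun x : 'cV[R]_d => enorm x).
Proof.
have /measurable_EFinP h := @measurable_enorm_sqr R d.
rewrite (_ : (fun x => _) = Num.sqrt \o (fun x : 'cV[R]_d => enorm x ^+ 2)).
  apply: measurableT_comp => //.
  by apply: continuous_measurable_fun; exact: sqrt_continuous.
by apply/funext => x /=; rewrite sqrtr_sqr ger0_norm// enorm_ge0.
Qed.

Section Atoms.
Variables (N : nat) (N_gt0 : (0 < N)%N).
Implicit Types (mu nu : P2 R d) (xs ys : 'I_N -> 'cV[R]_d).

(** The coupling that matches the i-th atoms costs the right-hand side. *)
Lemma W2_le_matched mu nu xs ys :
  (forall A, measurable A -> mu A = empirical_fun xs A) ->
  (forall A, measurable A -> nu A = empirical_fun ys A) ->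
  W2 mu nu ^+ 2 <= N%:R^-1 * \sum_i enorm (xs i - ys i) ^+ 2.
Proof.
move=> muE nuE.
pose pi := @uniform_atoms _ ('cV[R]_d * 'cV[R]_d)%type R N N_gt0 (fun i => (xs i, ys i)).
have cpl : coupling mu nu pi.
  move=> A mA; rewrite muE// nuE// /empirical_fun !uniform_atomsE.
  split; congr (_ * _)%E; apply: eq_bigr => i _; rewrite !diracE.
    by congr ((_ _)%:R%:E); apply/idP/idP; rewrite !inE => // -[].
  by congr ((_ _)%:R%:E); apply/idP/idP; rewrite !inE => // -[].
have inf_le : (ereal_inf [set (\int[pi]_z (enorm (z.1 - z.2) ^+ 2)%:E)%E | pi in coupling mu nu]
   <= (N%:R^-1 * \sum_i enorm (xs i - ys i) ^+ 2)%:E)%E.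
  apply: ereal_inf_lbound; exists pi => //.
  rewrite integral_uniform_atoms//; first exact: measurable_enorm_sub_sqr.
  by move=> z; exact: sqr_ge0.
have inf_ge0 : (0 <= ereal_inf [set (\int[pi]_z (enorm (z.1 - z.2) ^+ 2)%:E)%E | pi in coupling mu nu])%E.
  apply: le_ereal_inf_tmp => _ [q _ <-]; apply: integral_ge0 => z _.
  by rewrite lee_fin sqr_ge0.
rewrite /W2 sqr_sqrtr ?fine_ge0// -lee_fin fineK//.
by rewrite ge0_fin_numE// (le_lt_trans inf_le)// ltry.
Qed.

Lemma W2_empirical_le xs ys :
  W2 (empirical N_gt0 xs) (empirical N_gt0 ys) ^+ 2 <=
  N%:R^-1 * \sum_i enorm (xs i - ys i) ^+ 2.
Proof. by apply: W2_le_matched. Qed.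

(** The Dirac mass at 0 is the empirical measure of N atoms at 0. *)
Lemma W2_empirical_dirac0_le xs :
  W2 (empirical N_gt0 xs) (diracP2 0) ^+ 2 <= N%:R^-1 * \sum_i enorm (xs i) ^+ 2.
Proof.
rewrite (eq_bigr (fun i => enorm (xs i - 0) ^+ 2)); last by move=> i _; rewrite subr0.
apply: W2_le_matched => // A mA.
rewrite /empirical_fun; under eq_bigr do rewrite diracE.
rewrite sumEFin sumr_const card_ord -EFinM -(mulr_natl (0 \in A)%:R N) mulrA mulVf.
  by rewrite mul1r [LHS]diracE.
by rewrite pnatr_eq0 -lt0n.
Qed.

Lemma W2_0_empirical xs :
  W2_0 (empirical N_gt0 xs) ^+ 2 = N%:R^-1 * \sum_i enorm (xs i) ^+ 2.
Proof.
have E : (\int[empirical N_gt0 xs]_x (enorm x ^+ 2)%:E =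
    (N%:R^-1 * \sum_i enorm (xs i) ^+ 2)%:E)%E.
  rewrite (eq_measure_integral (uniform_atoms N_gt0 xs)).
    have /measurable_EFinP h := @measurable_enorm_sqr R d.
    by rewrite integral_uniform_atoms// => x; exact: sqr_ge0.
  by move=> A _ _; rewrite [RHS]uniform_atomsE.
rewrite /W2_0 E/= sqr_sqrtr// mulr_ge0// ?invr_ge0//.
by apply: sumr_ge0 => i _; exact: sqr_ge0.
Qed.

End Atoms.
End EmpiricalMeasures.

(** * Measurability of the scheme *)

Section CoefficientMeasurability.
Context {R : realType} {d m : nat}.
Variables (b : 'cV[R]_d -> P2 R d -> 'cV[R]_d)
          (sigma : 'cV[R]_d -> P2 R d -> 'M[R]_(d, m)).
Variables (K1 K2 L1 kappa : R).
Hypothesis hA1 : dissipative b sigma K1 K2.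
Hypothesis hA2 : polynomial_lipschitz b L1 kappa.
Variables (N : nat) (N_gt0 : (0 < N)%N).

Local Notation emp Z := (empirical N_gt0 (fun i => col i Z)).

Let col_close (Z Z' : 'M[R]_(d, N)) (e : R) i :
  (forall k l, `|Z k l - Z' k l| <= e) ->
  enorm (col i Z - col i Z') ^+ 2 <= d%:R * e ^+ 2.
Proof.
move=> ZZ'; rewrite enorm_sqrE -[d in d%:R](card_ord d) mulr_natl -sumr_const.
apply: ler_sum => k _; rewrite !mxE -[X in X <= _]real_normK ?num_real//.
by rewrite lerXn2r// nnegrE// (le_trans _ (ZZ' k i)).
Qed.

Let W2_close (Z Z' : 'M[R]_(d, N)) (e : R) :
  (forall k l, `|Z k l - Z' k l| <= e) ->
  W2 (emp Z) (emp Z') ^+ 2 <= d%:R * e ^+ 2.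
Proof.
move=> ZZ'; apply: (le_trans (W2_empirical_le _ _ _)).
have N0 : 0 < N%:R :> R by rewrite ltr0n.
rewrite -(ler_pM2l N0) mulrA mulfV ?gt_eqF// mul1r.
rewrite (_ : N%:R * _ = \sum_(i < N) d%:R * e ^+ 2); last first.
  by rewrite sumr_const card_ord -(mulr_natl (d%:R * e ^+ 2)).
by apply: ler_sum => i _; exact: col_close.
Qed.

Let drift_local_lipschitz j (Z : 'M[R]_(d, N)) : exists2 K : R, 0 <= K &
  forall (Z' : 'M[R]_(d, N)) (e : R), 0 < e -> e <= 1 ->
    (forall k l, `|Z k l - Z' k l| <= e) ->
    enorm (b (col j Z) (emp Z) - b (col j Z') (emp Z')) ^+ 2 <= K * e ^+ 2.
Proof.
have [L10 kappa1 Hb] := hA2.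
pose c := 2 * kappa - 2; have c0 : 0 <= c by rewrite /c; lra.
pose x := col j Z.
pose rho := 1 + (2 * enorm x ^+ 2 + 2 * d%:R).
have rho1 : 1 <= rho by rewrite lerDl addr_ge0// mulr_ge0// sqr_ge0.
pose q := enorm x `^ c; pose q' := rho `^ c.
have q0 : 0 <= q := powR_ge0 _ _; have q'0 : 0 <= q' := powR_ge0 _ _.
exists (L1 * ((1 + q + q') * d%:R + d%:R)).
  apply: mulr_ge0; first exact: ltW.
  by apply: addr_ge0 => //; apply: mulr_ge0 => //; apply: addr_ge0 => //; apply: addr_ge0.
move=> Z' e e0 e1 ZZ'; have cl := col_close j ZZ'; have wl := W2_close ZZ'.
apply: (le_trans (Hb _ _ _ _)).
rewrite -mulrA ler_pM2l// [X in _ <= X]mulrDl; apply: lerD => //.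
rewrite -[X in _ <= X]mulrA; apply: ler_pM => //.
- by rewrite !addr_ge0// powR_ge0.
- exact: sqr_ge0.
rewrite lerD2l; apply: ge0_ler_powR => //; rewrite ?nnegrE ?enorm_ge0//.
  by rewrite (le_trans _ rho1).
rewrite -(@ler_pXn2r _ 2)// ?nnegrE ?enorm_ge0//; last by rewrite (le_trans _ rho1).
have -> : col j Z' = x + (col j Z' - x) by rewrite addrC subrK.
apply: (le_trans (enorm_sqrD_le _ _)).
rewrite -(enormN (_ - x)) opprB.
have : d%:R * e ^+ 2 <= d%:R by rewrite ler_piMr// expr_le1// ltW.
move: cl; rewrite -/x => cl de.
apply: (@le_trans _ _ rho); first by rewrite /rho; lra.
by rewrite expr2 ler_peMr// (le_trans _ rho1).
Qed.

Let diffusion_local_lipschitz j (Z : 'M[R]_(d, N)) : exists2 K : R, 0 <= K &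
  forall (Z' : 'M[R]_(d, N)) (e : R), 0 < e -> e <= 1 ->
    (forall k l, `|Z k l - Z' k l| <= e) ->
    hsnorm (sigma (col j Z) (emp Z) - sigma (col j Z') (emp Z')) ^+ 2
      <= K * e ^+ 2.
Proof.
have [_ K20 K10 H] := hA1.
have [K K0 HK] := drift_local_lipschitz j Z.
exists (K2 * d%:R + d%:R + K); first by rewrite !addr_ge0// mulr_ge0.
move=> Z' e e0 e1 ZZ'; have cl := col_close j ZZ'; have wl := W2_close ZZ'.
have {}HK := HK Z' e e0 e1 ZZ'.
have := H (col j Z) (col j Z') (emp Z) (emp Z').
have := dot_le (col j Z - col j Z') (b (col j Z) (emp Z) - b (col j Z') (emp Z')).
set D := dot _ _; set X := enorm (col j Z - _) ^+ 2 in cl *.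
set B := enorm (b _ _ - _) ^+ 2 in HK *; set S := hsnorm _ ^+ 2.
set V := W2 _ _ ^+ 2 in wl *.
have X0 : 0 <= K1 * X by rewrite mulr_ge0// ?sqr_ge0// ltW.
have : K2 * V <= K2 * (d%:R * e ^+ 2) by exact: ler_wpM2l.
have := ler_norm (- D); rewrite normrN.
rewrite !mulrDl -mulrA mulNr; lra.
Qed.

(** As the empirical measure depends continuously on its atoms, the drift at an
    atom is a continuous function of the matrix of all atoms. *)
Lemma drift_continuous j (k : 'I_d) : continuous
  (fun Z : 'M[R]_(d, N) => b (col j Z) (emp Z) k ord0).
Proof.
apply: continuous_of_local_lipschitz => Z.
have [K K0 HK] := drift_local_lipschitz j Z.
exists K => // Z' e e0 e1 ZZ'; apply: le_trans (HK Z' e e0 e1 ZZ').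
rewrite enorm_sqrE (bigD1 k)//= !mxE lerDl sumr_ge0// => i _.
exact: sqr_ge0.
Qed.

(** The dissipativity condition bounds the increment of the diffusion coefficient
    by those of the position, of the measure and of the drift. *)
Lemma diffusion_continuous j (k : 'I_d) (l : 'I_m) : continuous
  (fun Z : 'M[R]_(d, N) => sigma (col j Z) (emp Z) k l).
Proof.
apply: continuous_of_local_lipschitz => Z.
have [K K0 HK] := diffusion_local_lipschitz j Z.
exists K => // Z' e e0 e1 ZZ'; apply: le_trans (HK Z' e e0 e1 ZZ').
rewrite hsnorm_sqrE (bigD1 k)//= (bigD1 l)//= !mxE -addrA lerDl.
by rewrite addr_ge0// sumr_ge0// => i _; [|apply: sumr_ge0 => ? _]; exact: sqr_ge0.
Qed.

Section Along.
Context {dT : measure_display} {T : measurableType dT}.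
Variable Y : 'I_N -> T -> 'cV[R]_d.
Hypothesis mY : forall i, measurable_fun setT (Y i).

Let Z (w : T) : 'M[R]_(d, N) := \matrix_(k, i) Y i w k ord0.

Let mZ : measurable_fun setT Z.
Proof.
apply: measurable_matrix => k i; rewrite /Z; under eq_fun do rewrite mxE.
exact: (measurableT_comp (@measurable_coord R d k) (mY i)).
Qed.

Let colZ w i : col i (Z w) = Y i w.
Proof. by apply/colP => k; rewrite !mxE. Qed.

Lemma measurable_drift j k :
  measurable_fun setT (fun w => b (Y j w) (empirical N_gt0 (Y ^~ w)) k ord0).
Proof.
have := measurable_continuous_comp (@drift_continuous j k) mZ.
rewrite (_ : _ \o _ = (fun w => b (Y j w) (empirical N_gt0 (Y ^~ w)) k ord0))//.
apply/funext => w /=; rewrite colZ.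
by congr (b _ (empirical _ _) _ _); apply/funext => i; rewrite colZ.
Qed.

Lemma measurable_diffusion j k l :
  measurable_fun setT (fun w => sigma (Y j w) (empirical N_gt0 (Y ^~ w)) k l).
Proof.
have := measurable_continuous_comp (@diffusion_continuous j k l) mZ.
rewrite (_ : _ \o _ = (fun w => sigma (Y j w) (empirical N_gt0 (Y ^~ w)) k l))//.
apply/funext => w /=; rewrite colZ.
by congr (sigma _ (empirical _ _) _ _); apply/funext => i; rewrite colZ.
Qed.

Lemma measurable_euler_proj (h : R) i :
  measurable_fun setT (fun w => euler_proj kappa h (Y i w)).
Proof.
apply: measurable_matrix => k l; rewrite (ord1 l) {l}.
rewrite (_ : (fun w => _) = (fun w => Num.min 1
    (h `^ (- (2 * (kappa + 2))^-1) * (enorm (Y i w)) `^ (-1)) * Y i w k ord0)).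
  apply: measurable_funM; last first.
    exact: (measurableT_comp (@measurable_coord R d k) (mY i)).
  apply: measurable_minr => //; apply: measurable_funM => //.
  apply: (measurableT_comp (@measurable_powR R (-1))).
  exact: (measurableT_comp (@measurable_enorm R d) (mY i)).
by apply/funext => w; rewrite mxE powR_inv1// enorm_ge0.
Qed.

End Along.

(** The sigma-algebra on T is arbitrary: it is used with the sigma-algebra of the
    past, which makes step K of the scheme independent of the next increment. *)
Lemma measurable_euler dT (T : measurableType dT) (h : R)
    (Wc : 'I_N -> R -> T -> 'cV[R]_m) (X0c : 'I_N -> T -> 'cV[R]_d) (K : nat) :
  (forall j, measurable_fun setT (X0c j)) ->
  (forall j (k : nat), (k <= K)%N -> measurable_fun setT (Wc j (k%:R * h))) ->
  forall k, (k <= K)%N -> forall j,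
    measurable_fun setT (euler b sigma kappa h N_gt0 Wc X0c k j).
Proof.
move=> mX0 mW; elim=> [|k IH] kK j /=; first exact: mX0.
have mY i : measurable_fun setT
    (fun w => euler_proj kappa h (euler b sigma kappa h N_gt0 Wc X0c k i w)).
  by apply: measurable_euler_proj => {}i; apply: IH; exact: ltnW.
apply: measurable_matrix => r l; rewrite (ord1 l) {l}.
rewrite (_ : (fun w => _) = (fun w =>
   euler_proj kappa h (euler b sigma kappa h N_gt0 Wc X0c k j w) r ord0 +
   h * b (euler_proj kappa h (euler b sigma kappa h N_gt0 Wc X0c k j w))
    (empirical N_gt0 (fun i => euler_proj kappa h (euler b sigma kappa h N_gt0 Wc X0c k i w))) r ord0 +
   \sum_i sigma (euler_proj kappa h (euler b sigma kappa h N_gt0 Wc X0c k j w))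
    (empirical N_gt0 (fun i => euler_proj kappa h (euler b sigma kappa h N_gt0 Wc X0c k i w))) r i *
     (Wc j (k.+1%:R * h) w - Wc j (k%:R * h) w) i ord0)).
  apply: measurable_funD; first apply: measurable_funD.
  - exact: (measurableT_comp (@measurable_coord R d r) (mY j)).
  - apply: measurable_funM => //.
    exact: (measurable_drift mY).
  - apply: measurable_sum => i; apply: measurable_funM.
      exact: (measurable_diffusion mY).
    by apply: measurable_coordB; apply: mW => //; exact: ltnW.
by apply/funext => w; rewrite !mxE.
Qed.

End CoefficientMeasurability.

(** * Convexity and the one-step drift *)

Section Convexity.
Context {R : realFieldType}.

Lemma expr_tangent_le (n : nat) (x m : R) : 0 <= x -> 0 <= m ->
  m ^+ n + n%:R * m ^+ n.-1 * (x - m) <= x ^+ n.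
Proof.
move=> x0 m0; elim: n => [|n IH]; first by rewrite !mul0r addr0.
have IHx := ler_wpM2l x0 IH; rewrite [X in _ <= X]exprS; apply: le_trans IHx.
case: n {IH} => [|n] /=; first by rewrite !expr0 expr1 mul0r mul1r; lra.
have q0 : 0 <= n.+1%:R * m ^+ n * (x - m) ^+ 2.
  by apply: mulr_ge0; [apply: mulr_ge0 => //; exact: exprn_ge0|exact: sqr_ge0].
rewrite -subr_ge0 (_ : _ - _ = n.+1%:R * m ^+ n * (x - m) ^+ 2)//.
rewrite -[n.+2%:R]natr1 !exprS; ring.
Qed.

(** Sum over i of the inequality saying that x^n lies above its tangent at the
    barycentre. *)
Lemma jensen_expr (I : finType) (p x : I -> R) (n : nat) :
  (forall i, 0 <= p i) -> (forall i, 0 <= x i) -> \sum_i p i = 1 ->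
  (\sum_i p i * x i) ^+ n <= \sum_i p i * x i ^+ n.
Proof.
move=> p0 x0 p1; set m := \sum_i p i * x i.
have m0 : 0 <= m by apply: sumr_ge0 => i _; exact: mulr_ge0.
have : \sum_i p i * (m ^+ n + n%:R * m ^+ n.-1 * (x i - m)) <=
       \sum_i p i * x i ^+ n.
  by apply: ler_sum => i _; apply: ler_wpM2l => //; exact: expr_tangent_le.
rewrite (eq_bigr (fun i => m ^+ n * p i +
   (n%:R * m ^+ n.-1 * (p i * x i) - n%:R * m ^+ n.-1 * m * p i))); last first.
  by move=> i _; ring.
by rewrite !big_split/= sumrN -!mulr_sumr p1 -/m !mulr1 subrr addr0.
Qed.

Lemma jensen_expr3 (n : nat) (p q r x y z : R) :
  0 <= p -> 0 <= q -> 0 <= r -> p + q + r = 1 ->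
  0 <= x -> 0 <= y -> 0 <= z ->
  (p * x + q * y + r * z) ^+ n <= p * x ^+ n + q * y ^+ n + r * z ^+ n.
Proof.
move=> p0 q0 r0 pqr x0 y0 z0.
have := @jensen_expr 'I_3 (fun i => [:: p; q; r]`_i) (fun i => [:: x; y; z]`_i) n.
rewrite !big_ord_recr !big_ord0/= !add0r; apply => //.
- by case=> -[|[|[|//]]].
- by case=> -[|[|[|//]]].
Qed.

Lemma jensen_expr_mean (N n : nat) (x : 'I_N -> R) : (0 < N)%N ->
  (forall i, 0 <= x i) ->
  (N%:R^-1 * \sum_i x i) ^+ n <= N%:R^-1 * \sum_i x i ^+ n.
Proof.
move=> N0 x0; have := @jensen_expr 'I_N (fun=> N%:R^-1) x n.
rewrite -!mulr_sumr; apply=> //.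
by rewrite sumr_const card_ord -(mulr_natr N%:R^-1) mulVf// pnatr_eq0 -lt0n.
Qed.

End Convexity.

Section OneStepDrift.
Context {R : realType} {d m : nat}.
Variables (b : 'cV[R]_d -> P2 R d -> 'cV[R]_d)
          (sigma : 'cV[R]_d -> P2 R d -> 'M[R]_(d, m)).
Variables (L1 kappa L2 q0 qstar a1 a2 C : R) (n : nat).
Hypothesis hA2 : polynomial_lipschitz b L1 kappa.
Hypothesis hL2 : 0 < L2.
Hypothesis hb0 : enorm (b 0 (diracP2 0)) <= L2.
Hypothesis hA4 : coercive b sigma q0 qstar a1 a2 C.
Hypothesis hn : n.*2.-1%:R <= qstar - 1.

Lemma enormZ (c : R) (x : 'cV[R]_d) : enorm (c *: x) = `|c| * enorm x.
Proof.
rewrite /enorm dotZl dotC dotZl mulrA -expr2 sqrtrM ?sqr_ge0//.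
by rewrite sqrtr_sqr.
Qed.

Lemma euler_proj_le_radius (h : R) (x : 'cV[R]_d) :
  enorm (euler_proj kappa h x) <= h `^ (- (2 * (kappa + 2))^-1).
Proof.
rewrite /euler_proj enormZ; set r := h `^ _.
have r0 : 0 <= r by exact: powR_ge0.
have rx0 : 0 <= r * (enorm x)^-1 by rewrite mulr_ge0// invr_ge0 enorm_ge0.
rewrite ger0_norm; last by rewrite le_min ler01 rx0.
have [->|x0] := eqVneq (enorm x) 0; first by rewrite mulr0.
apply: (@le_trans _ _ (r * (enorm x)^-1 * enorm x)).
  by rewrite ler_wpM2r ?enorm_ge0// ge_min lexx orbT.
by rewrite -mulrA mulVf// mulr1.
Qed.

Lemma euler_proj_le (h : R) (x : 'cV[R]_d) :
  enorm (euler_proj kappa h x) <= enorm x.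
Proof.
rewrite /euler_proj enormZ.
have rx0 : 0 <= h `^ (- (2 * (kappa + 2))^-1) * (enorm x)^-1.
  by rewrite mulr_ge0 ?powR_ge0// invr_ge0 enorm_ge0.
rewrite ger0_norm; last by rewrite le_min ler01 rx0.
by rewrite ler_piMl ?enorm_ge0// ge_min lexx.
Qed.

(** The projection radius is chosen so that h |b|^2 is of order [eta h] inside the
    ball; eta tends to 0 with h, and its inverse is the sixth power of the radius,
    so either eta is small or the projected iterates lie in a fixed ball. *)
Let eta (h : R) := h `^ (3 / (kappa + 2)).

Let kappa2 : 0 < kappa + 2.
Proof. by have [_ k1 _] := hA2; lra. Qed.

Let eta_gt0 h : 0 < h -> 0 < eta h. Proof. exact: powR_gt0. Qed.

Let h_le_eta h : 0 < h -> h <= 1 -> h <= eta h.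
Proof.
move=> h0 h1; apply: ger1_powR; first by rewrite h0.
by rewrite ler_pdivrMr// mul1r; have [_ k1 _] := hA2; lra.
Qed.

Let eta_le1 h : 0 < h -> h <= 1 -> eta h <= 1.
Proof.
move=> h0 h1; rewrite /eta -[leRHS](powRr0 h); apply: ger_powR.
  by rewrite h0.
by rewrite divr_ge0// ltW.
Qed.

Let radius_growth h (s : R) : 0 < h -> 0 <= s ->
  s <= h `^ (- (2 * (kappa + 2))^-1) -> h * s `^ (2 * kappa - 2) <= eta h.
Proof.
move=> h0 s0 sr; have [_ k1 _] := hA2.
have c0 : 0 <= 2 * kappa - 2 by lra.
apply: (@le_trans _ _ (h * (h `^ (- (2 * (kappa + 2))^-1)) `^ (2 * kappa - 2))).
  by rewrite ler_pM2l// ge0_ler_powR// nnegrE// powR_ge0.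
rewrite -powRrM -{1}[h](powRr1 (ltW h0)) -powRD; last by rewrite (gt_eqF h0) implybT.
rewrite /eta (_ : 1 + - (2 * (kappa + 2))^-1 * (2 * kappa - 2) = 3 / (kappa + 2))//.
by field; lra.
Qed.

Let radius_sixth h : 0 < h ->
  (h `^ (- (2 * (kappa + 2))^-1)) ^+ 6 = (eta h)^-1.
Proof.
move=> h0; rewrite -powR_mulrn ?powR_ge0// -powRrM -powRN; congr (_ `^ _).
by have k2 := kappa2; field; lra.
Qed.

Let c := 2 * L2 ^+ 2 + 6 * L1.

Let c_gt0 : 0 < c.
Proof.
have [L10 _ _] := hA2; rewrite addr_gt0// mulr_gt0//.
by rewrite exprn_gt0.
Qed.

(** Comparison of the drift with its value at 0 and the Dirac mass at 0 through the
    polynomial Lipschitz condition; the projection turns the factor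
    |x|^(2 kappa - 2) into a power of h. *)
Lemma drift_growth (h : R) (N : nat) (hN : (0 < N)%N) (xs : 'I_N -> 'cV[R]_d) j :
  0 < h -> h <= 1 -> enorm (xs j) <= h `^ (- (2 * (kappa + 2))^-1) ->
  h * enorm (b (xs j) (empirical hN xs)) ^+ 2 <=
  c * eta h * (1 + enorm (xs j) ^+ 2 + N%:R^-1 * \sum_i enorm (xs i) ^+ 2).
Proof.
move=> h0 h1 xr; have [L10 k1 Hb] := hA2.
set w := N%:R^-1 * _.
have w0 : 0 <= w by rewrite mulr_ge0 ?invr_ge0// sumr_ge0// => i _; exact: sqr_ge0.
set s := enorm (xs j) ^+ 2; have s0 : 0 <= s by exact: sqr_ge0.
have e0 := eta_gt0 h0; have he := h_le_eta h0 h1.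
set B := enorm _ ^+ 2.
pose g := enorm (xs j) `^ (2 * kappa - 2).
have g0 : 0 <= g := powR_ge0 _ _.
have hg : h * g <= eta h by apply: radius_growth => //; exact: enorm_ge0.
have z1 : enorm (0 : 'cV[R]_d) `^ (2 * kappa - 2) <= 1.
  rewrite enorm0; have [->|k0] := eqVneq (2 * kappa - 2) 0; first by rewrite powRr0.
  by rewrite powR0.
have HB : B <= 2 * L2 ^+ 2 + 2 * (L1 * ((2 + g) * s + w)).
  rewrite /B -[b _ _](addrNK (b 0 (diracP2 0))) addrC.
  apply: (le_trans (enorm_sqrD_le _ _)); apply: lerD.
    by rewrite ler_pM2l// lerXn2r// nnegrE ?enorm_ge0// ltW.
  rewrite ler_pM2l//; apply: (le_trans (Hb _ _ _ _)).
  rewrite subr0 ler_pM2l//; apply: lerD; last exact: W2_empirical_dirac0_le.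
  by rewrite ler_wpM2r//; move: z1; rewrite -/g; lra.
apply: (le_trans (ler_wpM2l (ltW h0) HB)).
rewrite /c.
have t1 : h * (2 * L2 ^+ 2) <= eta h * (2 * L2 ^+ 2).
  by rewrite ler_wpM2r// mulr_ge0 ?sqr_ge0.
have t2 : h * s <= eta h * s by rewrite ler_wpM2r.
have t3 : h * g * s <= eta h * s by rewrite ler_wpM2r.
have t4 : h * w <= eta h * w by rewrite ler_wpM2r.
have es0 : 0 <= eta h * s by rewrite mulr_ge0// ltW.
have ew0 : 0 <= eta h * w by rewrite mulr_ge0// ltW.
have t5 : 0 <= L1 * (3 * (eta h * s) + eta h * w - (2 * (h * s) + h * g * s + h * w)).
  by apply: mulr_ge0; [exact: ltW|lra].
have t6 : 0 <= L2 ^+ 2 * (eta h * s + eta h * w).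
  by rewrite mulr_ge0 ?sqr_ge0// addr_ge0.
have t7 : 0 <= L1 * (eta h * w) by rewrite mulr_ge0// ltW.
have t8 : 0 <= L1 * eta h by rewrite mulr_ge0// ltW.
rewrite -subr_ge0.
have -> : (2 * L2 ^+ 2 + 6 * L1) * eta h * (1 + s + w) -
  h * (2 * L2 ^+ 2 + 2 * (L1 * ((2 + g) * s + w))) =
  (eta h * (2 * L2 ^+ 2) - h * (2 * L2 ^+ 2)) +
  2 * (L1 * (3 * (eta h * s) + eta h * w - (2 * (h * s) + h * g * s + h * w)))
  + 2 * (L2 ^+ 2 * (eta h * s + eta h * w)) + 4 * (L1 * (eta h * w)) +
  6 * (L1 * eta h) by ring.
do 4! [apply: addr_ge0; last exact: mulr_ge0].
by rewrite subr_ge0.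
Qed.

(** Half of the gap a1 - a2 is kept as the weight of the constant term, and the
    other half pays for the term of order eta. *)
Let theta := (a1 - a2) / 4.
Let eta0 := Num.min (theta / c) a1^-1.
Let Q := 1 + eta0^-1 + a2 * (1 + eta0^-1) + C + c * (1 + 2 * (1 + eta0^-1)).
Let K := (C + theta) / (2 * theta).

(** The quantity that dominates |Y_{k+1}|^2 in the moment of order 2 n once the
    Gaussian noise is integrated out. *)
Definition step_base (h : R) (x : 'cV[R]_d) (mu : P2 R d) : R :=
  enorm (x + h *: b x mu) ^+ 2
  + n.*2.-1%:R * h * hsnorm (sigma x mu) ^+ 2.

Lemma step_base_ge0 h x mu : 0 < h -> 0 <= step_base h x mu.
Proof.
move=> h0; apply: addr_ge0; first exact: sqr_ge0.
by apply: mulr_ge0; [rewrite mulr_ge0// ltW|exact: sqr_ge0].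
Qed.

(** As 2 n - 1 <= qstar - 1, the cross term of the square and the diffusion term are
    together at most h times the left-hand side of the coercivity condition, so only
    h^2 |b|^2 is left over. *)
Lemma step_base_le (h : R) (N : nat) (hN : (0 < N)%N) (xs : 'I_N -> 'cV[R]_d) j :
  0 < h -> h <= 1 -> enorm (xs j) <= h `^ (- (2 * (kappa + 2))^-1) ->
  step_base h (xs j) (empirical hN xs) <=
  enorm (xs j) ^+ 2
  + h * (- a1 * enorm (xs j) ^+ 2
         + a2 * (N%:R^-1 * \sum_i enorm (xs i) ^+ 2) + C)
  + h * (c * eta h * (1 + enorm (xs j) ^+ 2
                      + N%:R^-1 * \sum_i enorm (xs i) ^+ 2)).
Proof.
move=> h0 h1 xr.
set s := enorm (xs j) ^+ 2; set w := N%:R^-1 * _.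
have [_ _ _ _ H4] := hA4.
rewrite /step_base enorm_sqrD enormZ (ger0_norm (ltW h0)) exprMn.
rewrite [dot _ (_ *: _)]dotC dotZl dotC.
have := H4 (xs j) (empirical hN xs).
rewrite W2_0_empirical -/s -/w.
set D := dot _ _; set S := hsnorm _ ^+ 2; set B := enorm (b _ _) ^+ 2 => H.
have S0 : 0 <= S by exact: sqr_ge0.
have HB : h * B <= c * eta h * (1 + s + w) by exact: drift_growth.
have H' : 2 * D + n.*2.-1%:R * S <= - a1 * s + a2 * w + C.
  apply: le_trans H; rewrite lerD2l; exact: ler_wpM2r.
have := ler_wpM2l (ltW h0) H'; have := ler_wpM2l (ltW h0) HB.
set E := h * (c * _ * _); set F := h * (- a1 * s + _ + _).
have -> : h ^+ 2 * B = h * (h * B) by ring.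
have -> : h * (2 * D + n.*2.-1%:R * S) = 2 * (h * D) + n.*2.-1%:R * h * S by ring.
lra.
Qed.

(** A bound by a convex combination makes every B above Kmax an invariant bound of
    the moments. For small eta the combination comes from the gap a1 > a2 and the
    convexity of the n-th power; for large eta the projected iterates are bounded
    and the whole weight is put on the constant. The weights depend on h, the
    constant does not. *)
Lemma one_step_drift : exists2 Kmax : R, 0 <= Kmax &
  forall (h : R) (N : nat) (hN : (0 < N)%N), 0 < h -> h <= 1 ->
  exists p q r : R, [/\ 0 <= p, 0 <= q, 0 <= r, p + q + r = 1 &
    forall (xs : 'I_N -> 'cV[R]_d) j,
    (forall i, enorm (xs i) <= h `^ (- (2 * (kappa + 2))^-1)) ->
    step_base h (xs j) (empirical hN xs) ^+ n <=
    p * enorm (xs j) ^+ n.*2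
    + q * (N%:R^-1 * \sum_i enorm (xs i) ^+ n.*2) + r * Kmax].
Proof.
have [a12 a20 _ C0 _] := hA4; have [L10 k1 _] := hA2.
have th0 : 0 < theta by rewrite /theta; lra.
have a10 : 0 < a1 by lra.
have eta00 : 0 < eta0 by rewrite lt_min divr_gt0//= invr_gt0.
have K0 : 0 <= K by apply: divr_ge0; [apply: addr_ge0|apply: mulr_ge0] => //; exact: ltW.
have ei0 : 0 < eta0^-1 by rewrite invr_gt0.
have c0 := c_gt0.
have Q0 : 0 <= Q.
  have u0 : 0 <= 1 + eta0^-1 by lra.
  have v1 : 0 <= a2 * (1 + eta0^-1) by exact: mulr_ge0.
  have v2 : 0 <= c * (1 + 2 * (1 + eta0^-1)).
    by apply: mulr_ge0; [exact: ltW|lra].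
  by rewrite /Q; lra.
exists (K ^+ n + Q ^+ n); first by rewrite addr_ge0// exprn_ge0.
move=> h N hN h0 h1.
have e0 := eta_gt0 h0; have e1 := eta_le1 h0 h1; have he := h_le_eta h0 h1.
have sum0 (xs : 'I_N -> 'cV[R]_d) : 0 <= N%:R^-1 * \sum_i enorm (xs i) ^+ 2.
  by rewrite mulr_ge0 ?invr_ge0// sumr_ge0// => i _; exact: sqr_ge0.
have [small|large] := leP (eta h) eta0.
- exists (1 - (a1 - theta) * h), ((a2 + theta) * h), (2 * theta * h).
  have cth : c * eta h <= theta.
    by rewrite mulrC -ler_pdivlMr// (le_trans small)// ge_min lexx.
  have ah : a1 * h <= 1.
    rewrite mulrC -ler_pdivlMr// mul1r (le_trans he)// (le_trans small)//.
    by rewrite ge_min lexx orbT.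
  have p0 : 0 <= 1 - (a1 - theta) * h.
    by have := mulr_gt0 th0 h0; lra.
  have q0' : 0 <= (a2 + theta) * h by apply: mulr_ge0; [apply: addr_ge0 => //|]; exact: ltW.
  have r0 : 0 <= 2 * theta * h.
    by apply: mulr_ge0; [apply: mulr_ge0 => //|]; exact: ltW.
  have pqr : 1 - (a1 - theta) * h + (a2 + theta) * h + 2 * theta * h = 1.
    by rewrite /theta; field.
  split=> // xs j xr.
  set s := enorm (xs j) ^+ 2; set w := N%:R^-1 * \sum_i enorm (xs i) ^+ 2.
  have s0 : 0 <= s by exact: sqr_ge0.
  have w0 : 0 <= w by exact: sum0.
  have HB := @step_base_le h N hN xs j h0 h1 (xr j).
  have HB' : step_base h (xs j) (empirical hN xs) <=
      (1 - (a1 - theta) * h) * s + (a2 + theta) * h * w + 2 * theta * h * K.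
    apply: (le_trans HB); rewrite -/s -/w.
    have t : h * (c * eta h * (1 + s + w)) <= h * (theta * (1 + s + w)).
      by rewrite ler_pM2l// ler_wpM2r//; apply: addr_ge0 => //; exact: addr_ge0.
    have -> : 2 * theta * h * K = h * (C + theta).
      by rewrite /K; field; exact: lt0r_neq0.
    lra.
  have B0 := @step_base_ge0 h (xs j) (empirical hN xs) h0.
  have := lerXn2r n B0 (le_trans B0 HB') HB'.
  move=> /le_trans; apply.
  apply: (le_trans (jensen_expr3 n p0 q0' r0 pqr s0 w0 K0)).
  apply: lerD; first apply: lerD.
  + by rewrite /s -exprM mul2n.
  + rewrite ler_wpM2l//.
    apply: (le_trans (jensen_expr_mean _ hN _)); first by move=> i; exact: sqr_ge0.
    rewrite ler_wpM2l ?invr_ge0// ler_sum// => i _.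
    by rewrite -exprM mul2n.
  + by rewrite ler_wpM2l// lerDl exprn_ge0.
- exists 0, 0, 1; split=> //; first by rewrite !add0r.
  move=> xs j xr; rewrite !mul0r !add0r mul1r.
  have HB := @step_base_le h N hN xs j h0 h1 (xr j).
  set s := enorm (xs j) ^+ 2 in HB; set w := N%:R^-1 * _ in HB.
  have B0 := @step_base_ge0 h (xs j) (empirical hN xs) h0.
  have w0 : 0 <= w by exact: sum0.
  have sbd i : enorm (xs i) ^+ 2 <= 1 + eta0^-1.
    have [|t1] := leP (enorm (xs i) ^+ 2) 1; first by move=> /le_trans; apply; rewrite lerDl ltW.
    (* the square of the norm is at most the cube root of 1 / eta h *)
    have : (enorm (xs i) ^+ 2) ^+ 3 <= eta0^-1.
      apply: (@le_trans _ _ (eta h)^-1); last by rewrite lef_pV2 ?posrE// ltW.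
      rewrite -radius_sixth// -exprM; apply: lerXn2r => //.
        by rewrite nnegrE enorm_ge0.
      by rewrite nnegrE powR_ge0.
    set u := enorm (xs i) ^+ 2 in t1 *; move=> u3.
    apply: (@le_trans _ _ (u ^+ 3)); last by apply: (le_trans u3); rewrite lerDr.
    by rewrite exprS ler_peMr ?(ltW (lt_trans ltr01 t1))// exprn_ege1// ltW.
  have wbd : w <= 1 + eta0^-1.
    have N0 : 0 < N%:R :> R by rewrite ltr0n.
    rewrite -(ler_pM2l N0) mulrA mulfV ?gt_eqF// mul1r.
    rewrite (_ : N%:R * _ = \sum_(i < N) (1 + eta0^-1)); last first.
      by rewrite sumr_const card_ord -(mulr_natl (1 + eta0^-1)).
    by apply: ler_sum.
  have sb : s <= 1 + eta0^-1 by exact: sbd.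
  have s0 : 0 <= s by exact: sqr_ge0.
  have BQ : step_base h (xs j) (empirical hN xs) <= Q.
    apply: (le_trans HB); rewrite /Q -/s -/w.
    have u1 : h * (a2 * w + C) <= a2 * (1 + eta0^-1) + C.
      apply: (@le_trans _ _ (a2 * w + C)).
        by rewrite ler_piMl// addr_ge0// mulr_ge0.
      by rewrite lerD2r ler_wpM2l.
    have u2 : h * (c * eta h * (1 + s + w)) <= c * (1 + 2 * (1 + eta0^-1)).
      apply: (@le_trans _ _ (c * eta h * (1 + s + w))).
        rewrite ler_piMl//; apply: mulr_ge0; first by apply: mulr_ge0; exact: ltW.
        by apply: addr_ge0 => //; exact: addr_ge0.
      apply: ler_pM => //.
      - by apply: mulr_ge0; exact: ltW.
      - by apply: addr_ge0 => //; exact: addr_ge0.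
      - by rewrite ler_piMr// ltW.
      - by lra.
    have u3 : 0 <= h * (a1 * s).
      by apply: mulr_ge0; [|apply: mulr_ge0 => //]; exact: ltW.
    lra.
  have := lerXn2r n B0 (le_trans B0 BQ) BQ.
  by move=> /le_trans; apply; rewrite lerDr exprn_ge0.
Qed.

End OneStepDrift.

(** * Moments of the scheme *)

Lemma same_law_integral {dO dT : measure_display} {Omega : measurableType dO}
    {T : measurableType dT} {R : realType} (P : probability Omega R)
    (X X' : Omega -> T) (f : T -> \bar R) :
  measurable_fun setT X -> measurable_fun setT X' ->
  (forall B, measurable B -> P (X @^-1` B) = P (X' @^-1` B)) ->
  measurable_fun setT f -> (forall x, 0 <= f x)%E ->
  (\int[P]_w f (X w) = \int[P]_w f (X' w))%E.
Proof.
move=> mX mX' law mf f0.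
pose D := distribution P (mfun_Sub (mem_set mX)).
pose D' := distribution P (mfun_Sub (mem_set mX')).
transitivity (\int[D]_x f x)%E; first by rewrite ge0_integral_distribution.
transitivity (\int[D']_x f x)%E; last by rewrite ge0_integral_distribution.
by apply: eq_measure_integral => B mB _; exact: law.
Qed.

Section UniformMoments.
Context {R : realType} {dO : measure_display} {Omega : measurableType dO}.
Variables (P : probability Omega R) (Ft : R -> set_system Omega) (d m : nat).
Variables (W : R -> Omega -> 'cV[R]_m) (X0 : Omega -> 'cV[R]_d).
Variables (b : 'cV[R]_d -> P2 R d -> 'cV[R]_d)
          (sigma : 'cV[R]_d -> P2 R d -> 'M[R]_(d, m)).
Variables (K1 K2 L1 kappa : R).
Hypothesis hFt : complete_filtration P Ft.
Hypothesis hW : brownian_motion P Ft W.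
Hypothesis hX0 : adapted_to (Ft 0) X0.
Hypothesis hA1 : dissipative b sigma K1 K2.
Hypothesis hA2 : polynomial_lipschitz b L1 kappa.
Variables (N : nat) (hN : (0 < N)%N) (h : R).
Hypothesis h0 : 0 < h.
Variables (Wc : 'I_N -> R -> Omega -> 'cV[R]_m) (X0c : 'I_N -> Omega -> 'cV[R]_d).
Hypothesis hiid : iid_copies P W X0 Wc X0c.

Local Notation Y := (euler b sigma kappa h hN Wc X0c).
Local Notation Ybar k := (fun i w => euler_proj kappa h (Y k i w)).

Let t0 (k : nat) : 0 <= k%:R * h. Proof. by rewrite mulr_ge0// ltW. Qed.

Lemma measurable_euler_past k j :
  measurable_fun [set: g_sigma_algebraType (copies_past Wc X0c (k%:R * h))]
    (Y k j).
Proof.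
apply: (@measurable_euler _ _ _ _ _ _ _ _ _ hA1 hA2 _ hN _ _ h _ _ k) => //.
  by move=> i; exact: measurable_fun_initial.
move=> i l lk; apply: measurable_fun_noise => //.
by rewrite ler_pM2r// ler_nat.
Qed.

Lemma measurable_euler_Omega k j : measurable_fun setT (Y k j).
Proof.
have PiM := @copies_past_measurable _ _ _ _ _ _ _ _ _ _ _ hiid (k%:R * h).
exact: (measurable_fun_generated PiM (@measurable_euler_past k j)).
Qed.

Lemma measurable_Ybar_past k i :
  measurable_fun [set: g_sigma_algebraType (copies_past Wc X0c (k%:R * h))]
    (Ybar k i).
Proof.
by apply: measurable_euler_proj => {}i; exact: measurable_euler_past.
Qed.

(** The iterates at step k are measurable for the past, and the increment of the
    noise is an independent Gaussian vector of variance h. *)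
Lemma euler_moment_step_le (n k : nat) (j : 'I_N) :
  (\int[P]_w (enorm (Y k.+1 j w) ^+ n.*2)%:E <=
   \int[P]_w (step_base b sigma n h (Ybar k j w)
                (empirical hN (Ybar k ^~ w)) ^+ n)%:E)%E.
Proof.
set s := k%:R * h; set t := k.+1%:R * h.
have ts : t - s = h by rewrite /t /s -natr1; ring.
have st : s < t by rewrite -subr_gt0 ts.
pose Pi := copies_past Wc X0c s.
pose mu w := empirical hN (Ybar k ^~ w).
pose u (r : 'I_d) (w : Omega) : R := (Ybar k j w + h *: b (Ybar k j w) (mu w)) r ord0.
pose a (r : 'I_d) (l : 'I_m) (w : Omega) : R := sigma (Ybar k j w) (mu w) r l.
pose X (l : 'I_m) (w : Omega) : R := (Wc j t w - Wc j s w) l ord0.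
have mY := @measurable_Ybar_past k.
have mdrift r := measurable_drift hA2 hN mY j r.
have mdiff r l := measurable_diffusion hA1 hA2 hN mY j r l.
have mu_ r : measurable_fun [set: g_sigma_algebraType Pi] (u r).
  rewrite (_ : u r = fun w => Ybar k j w r ord0 + h * b (Ybar k j w) (mu w) r ord0);
    last by apply/funext => w; rewrite /u mxE [(h *: b _ _) _ _]mxE.
  apply: measurable_funD.
    exact: (measurableT_comp (@measurable_coord R d r) (mY j)).
  by apply: measurable_funM => //; exact: mdrift.
have ma r l : measurable_fun [set: g_sigma_algebraType Pi] (a r l).
  exact: mdiff.
have s0 : 0 < Num.sqrt h by rewrite sqrtr_gt0.
have mX l : measurable_fun setT (X l) by apply: (measurable_increment hiid); exact: t0.
have indep S (B : 'I_m -> set R) : Pi S -> (forall l, measurable (B l)) ->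
    P (S `&` [set w | forall l, B l (X l w)]) =
    (P S * \prod_(l < m) normal_prob 0 (Num.sqrt h) (B l))%E.
  move=> PS mB; rewrite -ts.
  exact: (copies_increment_indep hFt hW hX0 hiid j (t0 k) st PS mB).
have := @gaussian_noise_moment_le _ _ _ P Pi m X (Num.sqrt h)
  (@copies_past_measurable _ _ _ _ _ _ _ _ _ _ _ hiid s) (@copies_pastI _ _ _ _ _ _ _ _ s) (copies_pastT _ _ s) s0 mX indep d n u a mu_ ma.
congr (_ <= _)%E.
  apply: eq_integral => w _; congr EFin.
  rewrite -mul2n exprM enorm_sqrE; congr (_ ^+ _).
  by apply: eq_bigr => r _; rewrite /u /a /X /= !mxE.
apply: eq_integral => w _; congr EFin; congr (_ ^+ _).
rewrite /step_base enorm_sqrE hsnorm_sqrE sqr_sqrtr ?ltW//.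
by rewrite [in RHS]exchange_big.
Qed.

Lemma measurable_step_base dT (T : measurableType dT) (n : nat)
    (Z : 'I_N -> T -> 'cV[R]_d) j :
  (forall i, measurable_fun setT (Z i)) ->
  measurable_fun setT
    (fun w => step_base b sigma n h (Z j w) (empirical hN (Z ^~ w))).
Proof.
move=> mZ.
rewrite (_ : (fun w => _) = (fun w =>
  \sum_r (Z j w r ord0 + h * b (Z j w) (empirical hN (Z ^~ w)) r ord0) ^+ 2 +
  n.*2.-1%:R * h *
    \sum_r \sum_l sigma (Z j w) (empirical hN (Z ^~ w)) r l ^+ 2)).
  apply: measurable_funD; last apply: measurable_funM => //.
    apply: measurable_sum => r; apply: measurable_funX; apply: measurable_funD.
      exact: (measurableT_comp (@measurable_coord R d r) (mZ j)).
    by apply: measurable_funM => //; exact: (measurable_drift hA2 hN mZ j r).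
  apply: measurable_sum => r; apply: measurable_sum => l; apply: measurable_funX.
  exact: (measurable_diffusion hA1 hA2 hN mZ j r l).
apply/funext => w; rewrite /step_base enorm_sqrE hsnorm_sqrE; congr (_ + _).
by apply: eq_bigr => r _; rewrite mxE [(h *: b _ _) _ _]mxE.
Qed.

(** The weights p, q, r sum to 1, so a bound B >= Kmax that holds for every
    particle at step k is reproduced at step k + 1. *)
Lemma euler_moments_bounded (n : nat) (p q r Kmax B : R) :
  0 <= p -> 0 <= q -> 0 <= r -> p + q + r = 1 -> 0 <= Kmax -> Kmax <= B ->
  (forall (xs : 'I_N -> 'cV[R]_d) j,
    (forall i, enorm (xs i) <= h `^ (- (2 * (kappa + 2))^-1)) ->
    step_base b sigma n h (xs j) (empirical hN xs) ^+ n <=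
    p * enorm (xs j) ^+ n.*2
    + q * (N%:R^-1 * \sum_i enorm (xs i) ^+ n.*2) + r * Kmax) ->
  (forall j, \int[P]_w (enorm (X0c j w) ^+ n.*2)%:E <= B%:E)%E ->
  forall k j, (\int[P]_w (enorm (Y k j w) ^+ n.*2)%:E <= B%:E)%E.
Proof.
move=> p0 q0 r0 pqr K0 KB step init; elim=> [|k IH] j; first exact: init.
have mY := @measurable_euler_Omega.
have mYbar i : measurable_fun setT (Ybar k i).
  by apply: measurable_euler_proj => {}i; exact: mY.
have menorm (Z : Omega -> 'cV[R]_d) : measurable_fun setT Z ->
    measurable_fun setT (fun w => (enorm (Z w) ^+ n.*2)%:E).
  move=> mZ; apply/measurable_EFinP/measurable_funX.
  exact: (measurableT_comp (@measurable_enorm R d) mZ).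
have pw0 (Z : 'cV[R]_d) : 0 <= enorm Z ^+ n.*2 by rewrite exprn_ge0// enorm_ge0.
have N0 : 0 < N%:R :> R by rewrite ltr0n.
have mom i : (\int[P]_w (enorm (Ybar k i w) ^+ n.*2)%:E <= B%:E)%E.
  apply: le_trans (IH i); apply: ge0_le_integral => //.
  - by move=> w _; rewrite lee_fin.
  - exact: menorm.
  - by apply: menorm; exact: mY.
  - move=> w _; rewrite lee_fin lerXn2r// ?nnegrE ?enorm_ge0//.
    exact: euler_proj_le.
apply: (le_trans (euler_moment_step_le n k j)).
pose V w : \bar R := (p%:E * (enorm (Ybar k j w) ^+ n.*2)%:E +
  ((q * N%:R^-1)%:E * \sum_i (enorm (Ybar k i w) ^+ n.*2)%:E + (r * Kmax)%:E))%E.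
have mV1 : measurable_fun setT
    (fun w => p%:E * (enorm (Ybar k j w) ^+ n.*2)%:E)%E.
  by apply: emeasurable_funM => //; exact: menorm.
have mS : measurable_fun setT (fun w => \sum_i (enorm (Ybar k i w) ^+ n.*2)%:E)%E.
  by apply: emeasurable_sum => i; exact: menorm.
have mV2 : measurable_fun setT
    (fun w => (q * N%:R^-1)%:E * \sum_i (enorm (Ybar k i w) ^+ n.*2)%:E)%E.
  exact: emeasurable_funM.
have qN0 : 0 <= q * N%:R^-1 by rewrite mulr_ge0// invr_ge0.
have S0 w : (0 <= \sum_i (enorm (Ybar k i w) ^+ n.*2)%:E)%E.
  by apply: sume_ge0 => i _; rewrite lee_fin.
have rK0 : 0 <= r * Kmax by rewrite mulr_ge0.
apply: (@le_trans _ _ (\int[P]_w V w)%E).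
  apply: ge0_le_integral => //.
  - by move=> w _; rewrite lee_fin exprn_ge0// step_base_ge0.
  - by apply/measurable_EFinP/measurable_funX; exact: measurable_step_base.
  - by apply: emeasurable_funD => //; exact: emeasurable_funD.
  - move=> w _; rewrite /V sumEFin -!EFinM -!EFinD lee_fin addrA -mulrA.
    by apply: step => i; exact: euler_proj_le_radius.
have -> : (\int[P]_w V w = p%:E * \int[P]_w (enorm (Ybar k j w) ^+ n.*2)%:E +
   ((q * N%:R^-1)%:E * \sum_i \int[P]_w (enorm (Ybar k i w) ^+ n.*2)%:E
    + (r * Kmax)%:E))%E.
  rewrite /V ge0_integralD//; last 3 first.
  - by move=> w _; rewrite mule_ge0// lee_fin.
  - by move=> w _; rewrite adde_ge0 ?mule_ge0// lee_fin.
  - exact: emeasurable_funD.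
  have mE i := menorm _ (mYbar i).
  have E0 i w : (0 <= (enorm (Ybar k i w) ^+ n.*2)%:E)%E by rewrite lee_fin.
  rewrite (ge0_integralZl P measurableT (mE j)) ?lee_fin//.
  congr (_ + _)%E.
  rewrite ge0_integralD//; last by move=> w _; rewrite mule_ge0// lee_fin.
  rewrite integral_cst// [X in (_ * X)%E](probability_setT P) mule1; congr (_ + _)%E.
  rewrite (ge0_integralZl P measurableT mS) ?lee_fin//.
  by congr (_ * _)%E; rewrite ge0_integral_sum.
apply: (@le_trans _ _ (p%:E * B%:E + ((q * N%:R^-1)%:E * \sum_(i < N) B%:E
   + (r * B)%:E))%E).
  apply: leeD; first by rewrite lee_wpmul2l ?lee_fin.
  apply: leeD; last by rewrite lee_fin ler_wpM2l.
  by rewrite lee_wpmul2l ?lee_fin// lee_sum.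
rewrite sumEFin -!EFinM -!EFinD lee_fin sumr_const card_ord -(mulr_natl B).
rewrite -mulrA (mulrA N%:R^-1) mulVf ?gt_eqF// mul1r addrA -!mulrDl pqr.
by rewrite mul1r.
Qed.

End UniformMoments.

(** Trades the real exponent of the statement for the even integer exponent 2 n,
    for which moments can be expanded. *)
Lemma powR_le_1Dexpr {R : realType} (x p : R) (n : nat) :
  0 <= x -> 0 <= p -> p <= n%:R -> x `^ p <= 1 + x ^+ n.
Proof.
move=> x0 p0 pn; have [x1|x1] := leP x 1.
  apply: (@le_trans _ _ 1); last by rewrite lerDl exprn_ge0.
  apply: (@le_trans _ _ (1 `^ p)); last by rewrite powR1.
  by rewrite ge0_ler_powR// nnegrE.
apply: (@le_trans _ _ (x ^+ n)); last by rewrite lerDr.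
by rewrite -powR_mulrn//; apply: ler_powR => //; exact: ltW.
Qed.

Theorem theorem3p6 (R : realType) (dO : measure_display)
  (Omega : measurableType dO) (P : probability Omega R)
  (Ft : R -> set_system Omega)
  (d m : nat)
  (W : R -> Omega -> 'cV[R]_m) (X0 : Omega -> 'cV[R]_d)
  (b : 'cV[R]_d -> P2 R d -> 'cV[R]_d)
  (sigma : 'cV[R]_d -> P2 R d -> 'M[R]_(d, m))
  (K1 K2 L1 kappa L2 q0 a1 a2 qstar C h0 p : R)
  (hFt : complete_filtration P Ft)
  (hW : brownian_motion P Ft W)
  (hX0 : adapted_to (Ft 0) X0)
  (hX0W : independent_systems P (generated_by X0) (generated_by_process W))
  (hA1 : dissipative b sigma K1 K2)
  (hA2 : polynomial_lipschitz b L1 kappa)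
  (hA3 : moment_bound P b X0 L2 q0)
  (hA4 : coercive b sigma q0 qstar a1 a2 C)
  (hh0 : 0 < h0 <= 1)
  (hp1 : 1 <= p) (hp2 : p < (Num.floor (q0 / 2))%:~R) :
  let h1 := Num.min (2 * (K1 - K2))^-1 h0 in
  let h2 := Num.min h1 (p * (a1 - a2))^-1 in
  exists K6 : R,
    forall (N M : nat) (hN : (0 < N)%N) (hM : (0 < M)%N)
      (Wc : 'I_N -> R -> Omega -> 'cV[R]_m) (X0c : 'I_N -> Omega -> 'cV[R]_d),
      iid_copies P W X0 Wc X0c ->
      let h := (M%:R : R)^-1 in
      h <= h2 ->
      let Y := euler b sigma kappa h hN Wc X0c in
      let initial :=
        ereal_sup (range (fun j => 'E_P[fun w => (1 + enorm (X0c j w) `^ (4 * p))%R]))%E in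
      (forall k : nat,
         (ereal_sup (range (fun j => 'E_P[fun w => (enorm (Y k j w) `^ (2 * p))%R]))
            <= K6%:E * initial)%E)
      /\ (K6%:E * initial
            = K6%:E * 'E_P[fun w => (1 + enorm (X0 w) `^ (4 * p))%R])%E.
Proof.
move=> h1 h2.
have [a12 a20 q0q _ _] := hA4.
have [L20 q020 mom0 b0] := hA3.
(* 2 n lies between 2 p, so that it controls the wanted moment, and q0, so that
   the initial moment is finite and n.*2.-1 <= qstar - 1. *)
pose n := `|Num.floor (q0 / 2)|%N.
have fl0 : (0 <= Num.floor (q0 / 2))%R.
  by rewrite floor_ge0 divr_ge0//; lra.
have nE : n%:R = (Num.floor (q0 / 2))%:~R :> R.
  by rewrite /n natr_absz ger0_norm.
have pn : p < n%:R by rewrite nE.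
have nq : n%:R <= q0 / 2 by rewrite nE; exact: floor_le.
have n0 : (0 < n)%N by rewrite -(ltr_nat R); lra.
have n2E : n.*2%:R = 2 * n%:R :> R by rewrite -mul2n natrM.
have hn : n.*2.-1%:R <= qstar - 1.
  have : n.*2.-1%:R + 1 = n.*2%:R :> R by rewrite natr1 prednK// double_gt0.
  by rewrite n2E; lra.
have [_ sFt _ _] := hFt.
have mX0 : measurable_fun setT X0.
  move=> _ B mB; rewrite setTI; have [_ FtM] := sFt 0 (lexx _).
  by apply: FtM; exact: hX0.
have mpow e : measurable_fun setT (fun x : 'cV[R]_d => enorm x `^ e).
  exact: (measurableT_comp (@measurable_powR R e) (@measurable_enorm R d)).
have mexp e : measurable_fun setT (fun x : 'cV[R]_d => enorm x ^+ e).
  by apply: measurable_funX; exact: measurable_enorm.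
have m1pow e : measurable_fun setT (fun x : 'cV[R]_d => (1 + enorm x `^ e)%:E).
  by apply/measurable_EFinP; exact: measurable_funD.
have p1 : 0 <= p by lra.
have fin0 : (\int[P]_w (enorm (X0 w) ^+ n.*2)%:E < +oo)%E.
  apply: (@le_lt_trans _ _ (\int[P]_w (1%:E + (enorm (X0 w) `^ (2 * q0))%:E))%E).
    apply: ge0_le_integral => //.
    - by move=> w _; rewrite lee_fin exprn_ge0// enorm_ge0.
    - by apply/measurable_EFinP; exact: (measurableT_comp (mexp _) mX0).
    - apply: emeasurable_funD => //.
      by apply/measurable_EFinP; exact: (measurableT_comp (mpow _) mX0).
    - move=> w _; rewrite -EFinD lee_fin.
      have [e1|e1] := leP (enorm (X0 w)) 1.
        apply: (@le_trans _ _ 1); last by rewrite lerDl powR_ge0.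
        by rewrite exprn_ile1// enorm_ge0.
      apply: (@le_trans _ _ (enorm (X0 w) `^ (2 * q0))); last by rewrite lerDr.
      rewrite -powR_mulrn ?enorm_ge0//.
      by apply: ler_powR; [exact: ltW|rewrite n2E; lra].
  rewrite ge0_integralD//; last 2 first.
  - by move=> w _; rewrite lee_fin powR_ge0.
  - by apply/measurable_EFinP; exact: (measurableT_comp (mpow _) mX0).
  rewrite integral_cst// [X in (_ * X)%E](probability_setT P) mule1.
  by move: mom0; rewrite unlock => mom0; rewrite lte_add_pinfty// ltry.
have [Kmax Kmax0 HK] := one_step_drift hA2 L20 b0 hA4 hn.
pose m0 : R := fine (\int[P]_w (enorm (X0 w) ^+ n.*2)%:E)%E.
have int0 : (0 <= \int[P]_w (enorm (X0 w) ^+ n.*2)%:E)%E.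
  by apply: integral_ge0 => w _; rewrite lee_fin exprn_ge0// enorm_ge0.
have m0E : (\int[P]_w (enorm (X0 w) ^+ n.*2)%:E = m0%:E)%E.
  by rewrite /m0 fineK// ge0_fin_numE.
have m00 : 0 <= m0 by exact: fine_ge0.
exists (1 + (Kmax + m0)).
move=> N M hN hM Wc X0c hiid h hh Y initial.
have hpos : 0 < h by rewrite invr_gt0 ltr0n.
have hle1 : h <= 1 by rewrite invf_le1 ?ltr0n// ler1n.
have mX0c j : measurable_fun setT (X0c j) by exact: (measurable_initial_copy hiid).
have E4 j : ('E_P[fun w => (1 + enorm (X0c j w) `^ (4 * p))%R] =
    'E_P[fun w => (1 + enorm (X0 w) `^ (4 * p))%R])%E.
  rewrite unlock.
  apply: (same_law_integral (f := fun x => (1 + enorm x `^ (4 * p))%:E)) => //.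
    by move=> B mB; exact: (copies_same_law hiid).
  by move=> x; rewrite lee_fin addr_ge0// powR_ge0.
have initE : initial = ('E_P[fun w => (1 + enorm (X0 w) `^ (4 * p))%R])%E.
  rewrite -[RHS]ereal_sup1; congr ereal_sup.
  apply/seteqP; split=> x /=; first by move=> [j _ <-]; rewrite E4.
  by move=> ->; exists (Ordinal hN) => //; rewrite E4.
split; last by rewrite initE.
(* as the initial term is at least 1, an absolute bound K6 is enough *)
have init1 : (1 <= initial)%E.
  rewrite initE unlock.
  apply: (@le_trans _ _ (\int[P]_w 1%:E)%E).
    by rewrite integral_cst// [X in (_ * X)%E](probability_setT P) mule1.
  apply: ge0_le_integral => //.
  - exact: (measurableT_comp (m1pow _) mX0).
  - by move=> w _; rewrite lee_fin lerDl powR_ge0.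
move=> k; apply: (@le_trans _ _ (1 + (Kmax + m0))%:E); last first.
  rewrite -[leLHS]mule1; apply: lee_wpmul2l => //.
  by rewrite lee_fin addr_ge0// addr_ge0.
apply: ge_ereal_sup => _ [j _ <-].
have [pp [qq [rr [pp0 qq0 rr0 pqr Hstep]]]] := HK h N hN hpos hle1.
have bound := @euler_moments_bounded _ _ _ P Ft d m W X0 b sigma K1 K2 L1 kappa
  hFt hW hX0 hA1 hA2 N hN h hpos Wc X0c hiid n pp qq rr Kmax (Kmax + m0)
  pp0 qq0 rr0 pqr Kmax0 ltac:(by rewrite lerDl) Hstep.
have {}bound := bound _ k j.
have mY : measurable_fun setT (Y k j).
  exact: (measurable_euler_Omega hA1 hA2 hN hpos hiid).
rewrite unlock.
apply: (@le_trans _ _ (\int[P]_w (1%:E + (enorm (Y k j w) ^+ n.*2)%:E))%E).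
  apply: ge0_le_integral => //.
  - by move=> w _; rewrite lee_fin powR_ge0.
  - by apply/measurable_EFinP; exact: (measurableT_comp (mpow _) mY).
  - apply: emeasurable_funD => //.
    by apply/measurable_EFinP; exact: (measurableT_comp (mexp _) mY).
  - move=> w _; rewrite -EFinD lee_fin powR_le_1Dexpr ?enorm_ge0//.
      by rewrite mulr_ge0.
    by rewrite n2E ler_pM2l// ltW.
rewrite ge0_integralD//; last 2 first.
- by move=> w _; rewrite lee_fin exprn_ge0// enorm_ge0.
- by apply/measurable_EFinP; exact: (measurableT_comp (mexp _) mY).
rewrite integral_cst// [X in (_ * X)%E](probability_setT P) mule1.
rewrite [X in (_ <= X)%E]EFinD; apply: leeD => //; apply: bound => i.
apply: (@le_trans _ _ m0%:E); last by rewrite lee_fin lerDr.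
rewrite -m0E.
rewrite (same_law_integral (X' := X0) (f := fun x => (enorm x ^+ n.*2)%:E))//.
- by move=> B mB; exact: (copies_same_law hiid).
- by apply/measurable_EFinP.
- by move=> x; rewrite lee_fin exprn_ge0// enorm_ge0.
Qed.
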